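(* Let $k\in\mathbb N$ be fixed. For an $N\times N$ unitary matrix $U$ and a fixed $\theta\in\mathbb R$ let $Z=Z(U,\theta)=\det(I-Ue^{-i\theta})$. As $N\to\infty$, the value distribution of $\log|Z|$ is asymptotically Gaussian with mean $k\log N$ and variance $\frac12\log N$ with respect to the measure $|Z|^{2k}d_{Haar}$ on $U(N)$; that is, for every fixed $V\in\mathbb R$, $$\lim_{N\to\infty}\frac{\mathbb E_{U(N)}\Big[|Z|^{2k}\,\mathbf 1\Big\{\tfrac{\log|Z|-k\log N}{\sqrt{\frac12\log N}}\ge V\Big\}\Big]}{\mathbb E_{U(N)}\big[|Z|^{2k}\big]}=\int_V^\infty e^{-x^2/2}\frac{dx}{\sqrt{2\pi}},$$ where $\mathbb E_{U(N)}$ denotes expectation with respect to Haar probability measure on the unitary group $U(N)$ (the circular unitary ensemble). *)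

(* Defs.v *)
From HB Require Import structures.
From mathcomp Require Import all_boot all_order all_algebra.
From mathcomp Require Import all_classical all_reals all_analysis.
From mathcomp Require Import complex.
Set Implicit Arguments. Unset Strict Implicit. Unset Printing Implicit Defensive.
Import Order.TTheory GRing.Theory Num.Theory.
Local Open Scope classical_set_scope.
Local Open Scope ring_scope.

Definition CMat (R : realType) (N : nat) : Type := 'M[R[i]]_N.
HB.instance Definition _ (R : realType) N := Choice.on (CMat R N).
HB.instance Definition _ (R : realType) N :=
  isPointed.Build (CMat R N) (0 : 'M[R[i]]_N).

(* Generators of the Borel sigma-algebra on C^{N x N} ~ R^{2 N^2}:
   preimages of Borel sets of R under the real / imaginary part of an entry. *)
Definition entry_gen (R : realType) (N : nat) : set (set (CMat R N)) :=
  [set A | exists (i j : 'I_N) (B : set R), measurable B /\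
     (A = (fun U : 'M[R[i]]_N => @complex.Re R (U i j)) @^-1` B \/
      A = (fun U : 'M[R[i]]_N => @complex.Im R (U i j)) @^-1` B)].

Notation MatSpace R N := (g_sigma_algebraType (@entry_gen R N)).

Definition adjmx (R : realType) (N : nat) (U : 'M[R[i]]_N) : 'M[R[i]]_N :=
  (map_mx (@conjc R) U)^T.
Definition unitary_mx (R : realType) (N : nat) : set 'M[R[i]]_N :=
  [set U | adjmx U *m U = 1%:M].

(* mu is (the push-forward to the matrix space of) Haar probability measure
   on U(N): a probability measure carried by U(N) and invariant under left
   multiplication by unitary matrices.  Such a measure exists and is unique. *)
Definition is_Haar_UN (R : realType) (N : nat)
    (mu : probability (MatSpace R N) R) : Prop :=
  measurable (@unitary_mx R N : set (MatSpace R N)) /\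
  mu (@unitary_mx R N) = 1%E /\
  forall V : 'M[R[i]]_N, @unitary_mx R N V ->
    forall A : set (MatSpace R N), measurable A ->
      mu ((fun U : 'M[R[i]]_N => V *m U) @^-1` A) = mu A.

Definition expmi (R : realType) (theta : R) : R[i] :=
  Complex (cos theta) (- sin theta).

Definition Zchar (R : realType) (N : nat) (theta : R) (U : 'M[R[i]]_N) : R[i] :=
  \det (1%:M - expmi theta *: U).
Definition absZ (R : realType) (N : nat) (theta : R) (U : 'M[R[i]]_N) : R :=
  let z := Zchar theta U in
  Num.sqrt ((@complex.Re R z) ^+ 2 + (@complex.Im R z) ^+ 2).

Definition weighted_mass (R : realType) (N k : nat) (theta : R)
    (mu : probability (MatSpace R N) R) (E : set (MatSpace R N)) : R :=
  fine (\int[mu]_(U in E) ((absZ theta (U : 'M[R[i]]_N)) ^+ (2 * k))%:E).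

Definition tail_event (R : realType) (N k : nat) (theta V : R) : set (MatSpace R N) :=
  [set U | V <= (ln (absZ theta (U : 'M[R[i]]_N)) - k%:R * ln N%:R)
                   / Num.sqrt (2^-1 * ln N%:R)].

Definition gauss_tail (R : realType) (V : R) : R :=
  fine (\int[lebesgue_measure]_(x in `[V, +oo[)
          (expR (- (x ^+ 2) / 2) / Num.sqrt (2 * pi))%:E).

(* Main.v *)
Require Import Defs.
From HB Require Import structures.
From mathcomp Require Import all_boot all_order all_algebra.
From mathcomp Require Import all_classical all_reals all_analysis.
From mathcomp Require Import complex.
From mathcomp Require Import measurable_realfun ring lra.
Import Order.TTheory GRing.Theory Num.Theory numFieldNormedType.Exports.
Local Open Scope classical_set_scope.
Local Open Scope ring_scope.
Set Implicit Arguments. Unset Strict Implicit. Unset Printing Implicit Defensive.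

(** Two applications of left invariance, one on [U(n+1)] and one on [U(n)], together with a Schur
    complement identity, show that [|det (1 - U)|] for [U] in [U(n+1)] is distributed as
    [|1 - u|] times an independent copy of [|det (1 - U')|] with [U'] in [U(n)], where [u] is the
    corner entry of a Haar matrix.  Hence under the weight [|Z|^{2k}] the variable [log |Z|] is a sum
    of independent variables.  Left invariance also gives the moments [E u = 0],
    [E (Re u)^2 = E (Im u)^2 = 1/(2N)] and [E |u|^4 = O(N^-2)], so that the weighted increments have
    mean [k/N] and variance [1/(2N)] up to [O(N^{-3/2})].

    The central limit theorem is then proved by Lindeberg's replacement method, with the test functions
    [x |-> Q ((c - x) / sqrt t)], where [Q] is the Gaussian tail: these solve the heat equation in
    [t], so that replacing one increment by a Gaussian amounts to changing [c] and [t], and the errors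
    [O(j^{-3/2})] are summable. *)

(** * The Gaussian tail *)

Section GaussTail.
Variable R : realType.
Implicit Types x V e : R.

(** The Taylor bounds need test functions on a scale at least 1, whereas the event is a sharp
    threshold. The test function therefore starts with standard deviation [dl * sqrt (ln N / 2)], a
    fixed fraction of the true one. The resulting limit is [Q (V / sqrt (1 + dl^2))], and [dl] tends
    to 0 only after the indicator has been squeezed between two shifted copies.

    Increments of small index are not small, and the errors from index [M] on add up only to
    [O(M^(-1/2))]. Replacement therefore stops at a fixed [M]: the weighted law of [log |Z|] on
    [U(M)] does not depend on [N] and is negligible on the scale [sqrt (ln N)].

    The Gaussian put in at step [j] has mean [k l] and variance [l / 2] with
    [l = ln j - ln (j - 1)], instead of [k / j] and [1 / (2 j)]. The change costs [O(j^(-2))], and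
    the parameters telescope exactly; this is how [k log N] and [(log N) / 2] arise.

    Moments of [|Z|] are never computed: each step is compared with its own mass [corner_mass],
    which is at least 1, so dividing by it does not enlarge errors. *)

Definition gauss_dens x : R := expR (- (x ^+ 2) / 2) / Num.sqrt (2 * pi).

Lemma gauss_densE : gauss_dens = normal_pdf 0 1.
Proof.
apply/funext => x; rewrite /gauss_dens normal_pdfE ?oner_eq0//.
rewrite /normal_peak /normal_fun mulrC subr0 !expr1n mul1r.
by rewrite -(mulr_natl pi 2) -[1 *+ 2]/(2%:R).
Qed.

Lemma gauss_dens_ge0 x : 0 <= gauss_dens x.
Proof. by rewrite gauss_densE normal_pdf_ge0. Qed.

Lemma integrable_gauss_dens (A : set R) : measurable A ->
  lebesgue_measure.-integrable A (EFin \o gauss_dens).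
Proof.
move=> mA; rewrite gauss_densE.
by apply: (@integrableS _ _ _ lebesgue_measure setT) => //; exact: integrable_normal_pdf.
Qed.

(** The moving endpoint becomes the upper one, the form required by the fundamental theorem of
    calculus and by [cdf]. *)
Lemma gauss_tailE V : gauss_tail V = 1 - \int[lebesgue_measure]_(x in `]-oo, V]) gauss_dens x.
Proof.
have H : \int[lebesgue_measure]_x gauss_dens x = 1.
  by rewrite /Rintegral gauss_densE integral_normal_pdf.
have iT : lebesgue_measure.-integrable setT (EFin \o gauss_dens) by exact: integrable_gauss_dens.
rewrite -H -set_itvNyy Rintegral_itvB//; last by rewrite set_itvNyy.
rewrite Rintegral_itv_obnd_cbnd//.
exact: integrable_gauss_dens.
Qed.

Lemma is_derive_gauss_tail x : is_derive x (1:R) (@gauss_tail R) (- gauss_dens x).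
Proof.
rewrite (_ : @gauss_tail R = fun V => 1 - \int[lebesgue_measure]_(x in `]-oo, V]) gauss_dens x);
  last by apply/funext => V; exact: gauss_tailE.
have [] := @continuous_FTC1 R gauss_dens -oo%O x (x + 1).
- by rewrite ltrDl.
- exact: integrable_gauss_dens.
- by rewrite ltNyr.
- by rewrite gauss_densE; apply: continuous_normal_pdf; rewrite oner_eq0.
move=> dF F'.
have iF : is_derive x (1:R) (fun x => \int[lebesgue_measure]_(x in `]-oo, x]) gauss_dens x) (gauss_dens x).
  apply: DeriveDef; first exact: dF.
  by rewrite -derive1E F'.
rewrite -[- gauss_dens x]add0r; exact: is_deriveB.
Qed.

Lemma gauss_tail_ge0 V : 0 <= gauss_tail V.
Proof.
by rewrite /gauss_tail fine_ge0// integral_ge0// => x _; rewrite lee_fin gauss_dens_ge0.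
Qed.

Lemma gauss_tail_le1 V : gauss_tail V <= 1.
Proof.
by rewrite gauss_tailE gerBl Rintegral_ge0// => x _; exact: gauss_dens_ge0.
Qed.

(** Monotonicity and the limits at infinity are inherited from the general facts on [cdf] through
    this representation. *)
Lemma gauss_tail_cdf : exists X : {RV (normal_prob 0 1 : probability (measurableTypeR R) R) >-> R},
  forall r, gauss_tail r = 1 - fine (cdf X r).
Proof.
pose P : probability (measurableTypeR R) R := normal_prob 0 1.
pose id' : measurableTypeR R -> R := idfun.
pose X : {RV P >-> R} := HB.pack id' (@isMeasurableFun.Build _ _ _ _ id' (@measurable_id _ _ setT)).
by exists X => r; rewrite gauss_tailE /cdf /= gauss_densE.
Qed.

Lemma le_gauss_tail x y : x <= y -> gauss_tail y <= gauss_tail x.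
Proof.
have [X E] := gauss_tail_cdf => xy; rewrite !E lerD2l lerN2.
by rewrite fine_le ?fin_num_measure// cdf_nondecreasing.
Qed.

Lemma gauss_tail_limits e : 0 < e ->
  exists r, [/\ 0 < r, gauss_tail r <= e & 1 - e <= gauss_tail (- r)].
Proof.
move=> e0; have [X E] := gauss_tail_cdf.
have c1 : (fine \o cdf X) x @[x --> +oo] --> (1 : R) by apply: fine_cvg; exact: cvg_cdfy1.
have : (fine \o cdf X) x @[x --> -oo] --> (0 : R) by apply: fine_cvg; exact: cvg_cdfNy0.
move/cvgNy_compNP => c0.
move/cvgrPdist_le : c1 => /(_ _ e0) h1.
move/cvgrPdist_le : c0 => /(_ _ e0) h0.
near (+oo : set_system R) => r; exists r; split.
- by near: r; exact: nbhs_pinfty_gt.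
- rewrite E; apply: (le_trans (ler_norm _)); near: r; exact: h1.
- rewrite E lerD2l lerN2; apply: (le_trans (ler_norm _)).
  rewrite -normrN -[X in `|X|]add0r; near: r; exact: h0.
Unshelve. all: by end_near. Qed.

Lemma continuous_gauss_tail : continuous (@gauss_tail R).
Proof.
move=> x; apply: differentiable_continuous; apply/derivable1_diffP.
by have [] := is_derive_gauss_tail x.
Qed.

Lemma measurable_gauss_tail : measurable_fun setT (@gauss_tail R).
Proof. by apply: continuous_measurable_fun; exact: continuous_gauss_tail. Qed.

Lemma sqrt_2pi_ge1 : 1 <= Num.sqrt (2 * pi) :> R.
Proof.
rewrite -[leLHS]sqrtr1 ler_wsqrtr//.
by have := pi_ge2 R; lra.
Qed.

(** The exponential is the square of [expR (- (x ^+ 2 / 4))], each factor is controlled by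
    [1 + t <= expR t], and the normalising constant is at least 1. A bound on a polynomial of degree
    at most 4 times the density thus becomes a polynomial inequality. *)
Lemma gauss_dens_decay x : gauss_dens x * (1 + x ^+ 2 / 4) ^+ 2 <= 1.
Proof.
have -> : gauss_dens x = expR (- (x ^+ 2 / 4)) ^+ 2 / Num.sqrt (2 * pi).
  by rewrite /gauss_dens -expRM_natl; congr (expR _ / _); field.
rewrite mulrAC ler_pdivrMr ?(lt_le_trans _ sqrt_2pi_ge1)//.
rewrite mul1r (le_trans _ sqrt_2pi_ge1)// -exprMn expRN exprMn -mulrC.
rewrite -exprMn exprn_ile1//.
  by rewrite divr_ge0 ?expR_ge0// addr_ge0// divr_ge0// sqr_ge0.
by rewrite ler_pdivrMr ?expR_gt0// mul1r expR_ge1Dx.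
Qed.

Lemma gauss_dens_weighted_ub x (c q : R) : `|q| <= c * (1 + x ^+ 2 / 4) ^+ 2 -> `|q * gauss_dens x| <= c.
Proof.
move=> qc; rewrite normrM (ger0_norm (gauss_dens_ge0 x)).
have g0 := gauss_dens_ge0 x; have gd := gauss_dens_decay x.
have s0 : 0 < (1 + x ^+ 2 / 4) ^+ 2 by rewrite exprn_gt0// ltr_pwDl// divr_ge0// sqr_ge0.
have c0 : 0 <= c by move: (le_trans (normr_ge0 _) qc); rewrite pmulr_lge0.
apply: (le_trans (ler_wpM2r g0 qc)).
by rewrite -mulrA mulrC [_ * gauss_dens x]mulrC ler_piMl.
Qed.

Lemma gauss_dens_ub1 x : `|gauss_dens x| <= 1.
Proof.
rewrite -[gauss_dens x]mul1r; apply: gauss_dens_weighted_ub.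
by rewrite normr1; nra.
Qed.

Lemma xgauss_dens_ub x : `|x * gauss_dens x| <= 1.
Proof. by apply: gauss_dens_weighted_ub; rewrite ler_norml; apply/andP; split; nra. Qed.

Lemma x2gauss_dens_ub x : `|(1 - x ^+ 2) * gauss_dens x| <= 2.
Proof. by apply: gauss_dens_weighted_ub; rewrite ler_norml; apply/andP; split; nra. Qed.

Lemma x3gauss_dens_ub x : `|x * (1 - x ^+ 2) * gauss_dens x| <= 5.
Proof.
apply: gauss_dens_weighted_ub; rewrite ler_norml; apply/andP; split.
  (* The square [(x ^+ 2 / 2 - x) ^+ 2] absorbs the cubic term at the price of [x ^+ 4 / 4], and the
     constant 5 provides [5 / 16] of [x ^+ 4]; the linear term goes into the square of
     [1 + x / 2]. *)
  have := sqr_ge0 (x ^+ 2 / 2 - x); have := sqr_ge0 (1 - x / 2); have := sqr_ge0 (1 + x / 2); have := sqr_ge0 x; nra.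
have := sqr_ge0 (x ^+ 2 / 2 + x); have := sqr_ge0 (1 - x / 2); have := sqr_ge0 (1 + x / 2);have := sqr_ge0 x; nra.
Qed.

Lemma is_derive_gauss_dens x : is_derive x (1 : R) gauss_dens (- (x * gauss_dens x)).
Proof.
have h : is_derive x (1 : R) (fun x : R => - x ^+ 2 / 2) (- x).
  by apply: is_derive_eq; rewrite /GRing.scale/=; field.
have := @is_derive1_comp R expR (fun x : R => - x ^+ 2 / 2) x _ _ (is_derive_expR _) h.
move=> d; rewrite (_ : gauss_dens = (Num.sqrt (2 * pi))^-1 \*: (expR \o (fun x : R => - x ^+ 2 / 2)));
  last by apply/funext => y; rewrite /gauss_dens mulrC.
by apply: is_derive_eq; rewrite /GRing.scale/= /GRing.scale/= /comp; ring.
Qed.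

Lemma is_derive_xgauss_dens x : is_derive x (1 : R) (fun x => x * gauss_dens x) ((1 - x ^+ 2) * gauss_dens x).
Proof.
have h := is_derive_gauss_dens x.
have d := is_deriveM (is_derive_id x (1:R)) h.
by apply: (is_derive_eq d); rewrite /GRing.scale/=; ring.
Qed.
End GaussTail.

(** * Taylor bounds from the mean value theorem *)

Section Taylor.
Variable R : realType.
Implicit Types (f df : R -> R) (x y h M : R).

(** No order is imposed on [x] and [y], since increments of both signs occur. *)
Lemma MVT_between f df x y :
  (forall c, Num.min x y <= c <= Num.max x y -> is_derive c (1 : R) f (df c)) ->
  exists2 c, Num.min x y <= c <= Num.max x y & f y - f x = df c * (y - x).
Proof.
move=> fd.
have [xy|yx] := leP x y.
  have [c cxy E] : exists2 c, c \in `[x, y]%R & f y - f x = df c * (y - x).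
    apply: MVT_segment => //.
      move=> c; rewrite in_itv/= => /andP[xc cy]; apply: fd.
      by rewrite (min_idPl xy) (max_idPr xy) !ltW.
    apply: derivable_within_continuous => c; rewrite in_itv/= => cxy.
    by have [] := fd c; rewrite // (min_idPl xy) (max_idPr xy).
  by exists c => //; move: cxy; rewrite in_itv/=.
have [c cxy E] : exists2 c, c \in `[y, x]%R & f x - f y = df c * (x - y).
  apply: MVT_segment => //; first exact: ltW.
    move=> c; rewrite in_itv/= => /andP[xc cy]; apply: fd.
    by rewrite (min_idPr (ltW yx)) (max_idPl (ltW yx)) !ltW.
  apply: derivable_within_continuous => c; rewrite in_itv/= => cxy.
  by have [] := fd c; rewrite // (min_idPr (ltW yx)) (max_idPl (ltW yx)).
exists c; first by move: cxy; rewrite in_itv/=.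
by rewrite -opprB E -mulrN opprB.
Qed.

Lemma taylor1 f df M x h : (forall c, is_derive c (1 : R) f (df c)) ->
  (forall c, `|c - x| <= `|h| -> `|df c| <= M) -> `|f (x + h) - f x| <= M * `|h|.
Proof.
move=> fd fM; have [c cb ->] := @MVT_between f df x (x + h) (fun c _ => fd c).
rewrite addrAC subrr add0r normrM ler_wpM2r// fM//.
move: cb; have [xy|yx] := leP x (x + h).
  by move=> /andP[? ?]; rewrite !ger0_norm; lra.
by move=> /andP[? ?]; rewrite !ler0_norm; lra.
Qed.

(** [taylor1] is applied to the remainder as a function of the endpoint; its derivative
    [f1 y - f1 x] is again bounded by [taylor1]. The factor [1 / 2] is lost, as is [1 / 6] in
    [taylor3], which affects constants only. *)
Lemma taylor2 f f1 f2 M x h : (forall c, is_derive c (1 : R) f (f1 c)) ->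
  (forall c, is_derive c (1 : R) f1 (f2 c)) -> (forall c, `|f2 c| <= M) ->
  `|f (x + h) - f x - h * f1 x| <= M * `|h| ^+ 2.
Proof.
move=> d1 d2 f2M.
have M0 : 0 <= M := le_trans (normr_ge0 _) (f2M 0).
have /= := @taylor1 (fun y => f y - (y - x) * f1 x) (fun y => f1 y - f1 x) (M * `|h|) x h.
rewrite (_ : _ - _ - _ = f (x + h) - f x - h * f1 x); last by ring.
rewrite -mulrA -expr2; apply.
  move=> c.
  have h1 : is_derive c (1 : R) (fun y => (y - x) * f1 x) (f1 x).
    rewrite (_ : (fun y => _) = (f1 x \*: (fun y : R => y - x))); last first.
      by apply/funext => y; rewrite mulrC.
    by apply: is_derive_eq; rewrite /GRing.scale/=; ring.
  exact: is_deriveB.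
move=> c cx; have := @taylor1 f1 f2 M x (c - x) d2 (fun c _ => f2M c).
by rewrite [x + _]addrC subrK => /le_trans; apply; rewrite ler_wpM2l.
Qed.

Lemma taylor3 f f1 f2 f3 M x h : (forall c, is_derive c (1 : R) f (f1 c)) ->
  (forall c, is_derive c (1 : R) f1 (f2 c)) -> (forall c, is_derive c (1 : R) f2 (f3 c)) ->
  (forall c, `|f3 c| <= M) ->
  `|f (x + h) - f x - h * f1 x - h ^+ 2 / 2 * f2 x| <= M * `|h| ^+ 3.
Proof.
move=> d1 d2 d3 f3M.
have M0 : 0 <= M := le_trans (normr_ge0 _) (f3M 0).
have := @taylor1 (fun y => f y - (y - x) * f1 x - (y - x) ^+ 2 / 2 * f2 x)
  (fun y => f1 y - f1 x - (y - x) * f2 x) (M * `|h| ^+ 2) x h.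
rewrite (_ : _ - _ - _ - _ = f (x + h) - f x - h * f1 x - h ^+ 2 / 2 * f2 x); last by ring.
rewrite (_ : M * _ * _ = M * `|h| ^+ 3); last by ring.
apply.
  move=> c.
  have h1 : is_derive c (1 : R) (fun y => (y - x) * f1 x) (f1 x).
    rewrite (_ : (fun y => _) = (f1 x \*: (fun y : R => y - x))); last first.
      by apply/funext => y; rewrite mulrC.
    by apply: is_derive_eq; rewrite /GRing.scale/=; ring.
  have h2 : is_derive c (1 : R) (fun y => (y - x) ^+ 2 / 2 * f2 x) ((c - x) * f2 x).
    rewrite (_ : (fun y => _) = ((f2 x / 2) \*: ((fun y : R => y - x) ^+ 2))); last first.
      by apply/funext => y; rewrite /= /GRing.scale/= exprfctE; ring.
    by apply: is_derive_eq; rewrite /GRing.scale/=; field.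
  by apply: is_deriveB; exact: is_deriveB.
move=> c cx; have := @taylor2 f1 f2 f3 M x (c - x) d2 d3 f3M.
rewrite [x + _]addrC subrK => /le_trans; apply; rewrite ler_wpM2l//.
by rewrite ler_pXn2r ?nnegrE.
Qed.

Lemma norm_le_between (w c : R) : Num.min 0 w <= c <= Num.max 0 w -> `|c| <= `|w|.
Proof.
have [w0|w0] := leP 0 w.
  by move=> /andP[? ?]; rewrite !ger0_norm.
by move=> /andP[? ?]; rewrite !ler0_norm ?lerN2// ltW.
Qed.

Lemma is_derive_ln1D (c : R) : -1 < c -> is_derive c (1 : R) (fun w => ln (1 + w)) (1 + c)^-1.
Proof.
move=> c1; have c0 : 0 < 1 + c by lra.
have := is_deriveD (is_derive_cst (1 : R) c (1 : R)) (is_derive_id c (1 : R)).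
rewrite add0r => d1.
have := @is_derive1_comp R (@ln R) (fun w => 1 + w) c _ _ (is_derive1_ln c0) d1.
by rewrite mulr1.
Qed.

(** The threshold [- (3 / 4)] is the least value of [- 2 a + rho ^+ 2] for [|a| <= rho <= 1 / 2].
    Above it [(1 + c)^-1 <= 4], and the derivative of the remainder is [- c / (1 + c)]. *)
Lemma ln1D_taylor2 (w : R) : - (3 / 4) <= w -> `|ln (1 + w) - w| <= 4 * `|w| ^+ 2.
Proof.
move=> w34.
have cw c : Num.min 0 w <= c <= Num.max 0 w -> -(3/4) <= c.
  by have [|] := leP 0 w => ? /andP[? ?]; lra.
have [c|c cb] := @MVT_between (fun w => ln (1 + w) - w) (fun w => (1 + w)^-1 - 1) 0 w.
  move=> /cw c34; have := @is_derive_ln1D c; rewrite (_ : -1 < c); last by lra.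
  by move=> /(_ isT) d; exact: is_deriveB.
rewrite addr0 ln1 !subr0 => ->; have := norm_le_between cb; have := cw _ cb => c34 cn.
rewrite normrM expr2 mulrA ler_wpM2r// (le_trans _ (ler_wpM2l _ cn))//.
rewrite (_ : _ - 1 = (1 + c)^-1 * - c); last by field; apply/eqP; lra.
rewrite normrM normrN ler_wpM2r// ger0_norm ?invr_ge0; last by lra.
by rewrite -[leRHS]invrK lef_pV2 ?posrE; lra.
Qed.

Lemma ln1D_taylor3 (w : R) : - (3 / 4) <= w ->
  `|ln (1 + w) - w + w ^+ 2 / 2| <= 4 * `|w| ^+ 3.
Proof.
move=> w34.
have cw c : Num.min 0 w <= c <= Num.max 0 w -> -(3/4) <= c.
  by have [|] := leP 0 w => ? /andP[? ?]; lra.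
have [c|c cb] := @MVT_between (fun w => ln (1 + w) - w + w ^+ 2 / 2) (fun w => (1 + w)^-1 - 1 + w) 0 w.
  move=> /cw c34; have := @is_derive_ln1D c; rewrite (_ : -1 < c); last by lra.
  move=> /(_ isT) d.
  have d2 : is_derive c (1 : R) (fun w : R => w ^+ 2 / 2) c.
    by apply: is_derive_eq; rewrite /GRing.scale/=; field.
  by apply: is_deriveD; exact: is_deriveB.
rewrite addr0 ln1 !subr0 expr0n/= mul0r addr0 subr0 => ->.
have := norm_le_between cb; have := cw _ cb => c34 cn.
rewrite normrM exprSr mulrA ler_wpM2r//.
rewrite (_ : _ - 1 + c = (1 + c)^-1 * c ^+ 2); last by field; apply/eqP; lra.
rewrite normrM normrX ler_pM// ?ler_pXn2r ?nnegrE// ger0_norm ?invr_ge0; last by lra.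
by rewrite -[leRHS]invrK lef_pV2 ?posrE; lra.
Qed.
End Taylor.

(** * One replacement step *)

Section Heat.
Variable R : realType.
Implicit Types (x y a b e z d sg l h : R).

Lemma norm_leD x y a b : `|x| <= a -> `|y| <= b -> `|x + y| <= a + b.
Proof. by move=> xa yb; rewrite (le_trans (ler_normD _ _))// lerD. Qed.

Lemma norm_leM x y a b : `|x| <= a -> `|y| <= b -> `|x * y| <= a * b.
Proof. by move=> xa yb; rewrite normrM ler_pM. Qed.

Lemma is_derive_Ngauss_dens x : is_derive x (1 : R) (fun x => - @gauss_dens R x) (x * gauss_dens x).
Proof. by rewrite -[X in is_derive _ _ _ X]opprK; apply: is_deriveN; exact: is_derive_gauss_dens. Qed.

Lemma gauss_tail_taylor2 z h : `|gauss_tail (z - h) - gauss_tail z - h * gauss_dens z| <= `|h| ^+ 2.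
Proof.
have := @taylor2 R _ _ _ 1 z (- h) (@is_derive_gauss_tail R) is_derive_Ngauss_dens (@xgauss_dens_ub R).
by rewrite mulrNN mul1r normrN.
Qed.

Lemma gauss_tail_taylor3 z h :
  `|gauss_tail (z - h) - gauss_tail z - h * gauss_dens z - h ^+ 2 / 2 * (z * gauss_dens z)| <= 2 * `|h| ^+ 3.
Proof.
have := @taylor3 R _ _ _ _ 2 z (- h) (@is_derive_gauss_tail R) is_derive_Ngauss_dens
  (@is_derive_xgauss_dens R) (@x2gauss_dens_ub R).
by rewrite mulrNN sqrrN normrN.
Qed.

Lemma xgauss_dens_lipschitz z h : `|(z - h) * gauss_dens (z - h) - z * gauss_dens z| <= 2 * `|h|.
Proof.
have := @taylor1 R _ _ 2 z (- h) (@is_derive_xgauss_dens R) (fun c _ => x2gauss_dens_ub c).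
by rewrite normrN.
Qed.

(** Writing the scale as [expR (- t)] makes both derivatives in [t] functions of
    [y = z * expR (- t)] alone, and the second is bounded by [x3gauss_dens_ub]; hence the error is
    uniform in [z]. *)
Lemma gauss_tail_scale z d :
  `|gauss_tail (z * expR (- d)) - gauss_tail z - d * (z * gauss_dens z)| <= 5 * `|d| ^+ 2.
Proof.
pose y t := z * expR (- t).
have dy t : is_derive t (1 : R) y (- y t).
  have dN : is_derive t (1 : R) (fun t => - t) (- 1) by apply: is_deriveN.
  have dE := @is_derive1_comp R expR (fun t => - t) t _ _ (is_derive_expR _) dN.
  have := is_deriveZ z dE.
  by rewrite /GRing.scale/= mulrN1 mulrN.
have d1 t : is_derive t (1 : R) (fun t => gauss_tail (y t)) (y t * gauss_dens (y t)).
  have := @is_derive1_comp R (@gauss_tail R) y t _ _ (is_derive_gauss_tail _) (dy t).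
  by rewrite mulrNN mulrC.
have d2 t : is_derive t (1 : R) (fun t => y t * gauss_dens (y t)) (- (y t * (1 - y t ^+ 2) * gauss_dens (y t))).
  have := @is_derive1_comp R (fun x => x * gauss_dens x) y t _ _ (is_derive_xgauss_dens _) (dy t).
  by rewrite mulrN mulrC mulrA.
have := @taylor2 R _ _ _ 5 0 d d1 d2.
rewrite /y add0r oppr0 expR0 mulr1; apply => c.
by rewrite normrN x3gauss_dens_ub.
Qed.

(** The Gaussian side of a replacement. The two density terms are the first and second derivatives
    of [gauss_tail ((e - h) / sg)] in [h] at 0. A mean [k l] contributes the first derivative, and a
    variance [l / 2] contributes half of itself times the second: this is the heat equation. *)
Lemma heat_step (k : nat) sg l e : 1 <= sg -> 0 <= l <= 1 ->
  `|gauss_tail ((e - k%:R * l) / Num.sqrt (sg ^+ 2 + l / 2)) - gauss_tail (e / sg)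
    - k%:R * l * (gauss_dens (e / sg) / sg) - l / 4 * (e / sg * gauss_dens (e / sg) / sg ^+ 2)|
  <= (k%:R ^+ 2 + 2 * k%:R + 6) * l ^+ 2.
Proof.
move=> sg1 /andP[l0 l1].
have sg0 : 0 < sg by lra.
have sgn0 : sg != 0 by rewrite gt_eqF.
pose q := l / (2 * sg ^+ 2).
have sg21 : 1 <= sg ^+ 2 by rewrite exprn_ege1.
have q0 : 0 <= q by rewrite divr_ge0// mulr_ge0// sqr_ge0.
have ql : q <= l / 2.
  rewrite /q invfM mulrA ler_piMr//; first by rewrite divr_ge0.
  by rewrite invf_le1// exprn_gt0.
(* The new standard deviation is [sg * expR d], so the change of variance is a rescaling covered by
   [gauss_tail_scale]. *)
pose d := ln (1 + q) / 2.
have dq : `|d - q / 2| <= l ^+ 2 / 2.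
  have := @ln1D_taylor2 R q; rewrite (_ : _ <= q); last by lra.
  move=> /(_ isT); rewrite (ger0_norm q0) => H.
  rewrite /d -mulrBl normrM (ger0_norm (_ : 0 <= 2^-1)); last by lra.
  by rewrite ler_wpM2r ?invr_ge0// (le_trans H)//; nra.
have dl : `|d| <= l.
  rewrite -[d](subrK (q / 2)); apply: le_trans (norm_leD dq (lexx _)) _.
  by rewrite ger0_norm; nra.
have -> : Num.sqrt (sg ^+ 2 + l / 2) = sg * expR d.
  have se0 : 0 <= sg * expR d by rewrite mulr_ge0 ?expR_ge0 ?ltW.
  rewrite -[RHS](ger0_norm se0) -sqrtr_sqr; congr Num.sqrt.
  rewrite exprMn -expRM_natl (_ : 2%:R * d = ln (1 + q)); last by rewrite /d; field.
  by rewrite lnK ?posrE; [rewrite /q; field|lra].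
pose z := e / sg; pose h := k%:R * l / sg.
rewrite (_ : (e - k%:R * l) / _ = (z - h) * expR (- d)); last first.
  by rewrite expRN invfM mulrA mulrBl.
have hl : `|h| <= k%:R * l.
  rewrite ger0_norm; last by rewrite !mulr_ge0// ?invr_ge0 ltW.
  by rewrite /h ler_piMr ?mulr_ge0// invf_le1.
have Ta := gauss_tail_scale (z - h) d.
have Tb := gauss_tail_taylor2 z h.
have Tc := xgauss_dens_lipschitz z h.
have Td := norm_leM dq (xgauss_dens_ub z).
have Tcd := norm_leM dl Tc.
(* Error of the rescaling, error of the shift, cross term of the two, and the replacement of [d] by
   [q / 2]; each is [O(l ^+ 2)]. *)
rewrite (_ : _ - _ - _ - _ = (gauss_tail ((z - h) * expR (- d)) - gauss_tail (z - h) - d * ((z - h) * gauss_dens (z - h))) +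
  (gauss_tail (z - h) - gauss_tail z - h * gauss_dens z) +
  d * ((z - h) * gauss_dens (z - h) - z * gauss_dens z) + (d - q / 2) * (z * gauss_dens z)); last first.
  by rewrite -/z /q /h; field.
apply: le_trans (norm_leD (norm_leD (norm_leD Ta Tb) Tcd) Td) _.
have h2 : `|h| ^+ 2 <= (k%:R * l) ^+ 2 by rewrite ler_pXn2r ?nnegrE ?mulr_ge0.
have d2 : `|d| ^+ 2 <= l ^+ 2 by rewrite ler_pXn2r ?nnegrE.
have : l * (2 * `|h|) <= l * (2 * (k%:R * l)) by rewrite !ler_wpM2l.
have := sqr_ge0 l.
move: h2 d2; rewrite exprMn; nra.
Qed.

(** Induction on [k]: the old error is multiplied by at most 3 and the new term [k w ^+ 2] costs at
    most [4 ^+ k] times [w ^+ 2], which together give the factor 4. *)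
Lemma pow_taylor2 (k : nat) (w : R) : `|w| <= 2 ->
  `|(1 + w) ^+ k - 1 - k%:R * w| <= 4 ^+ k * `|w| ^+ 2.
Proof.
move=> w2; elim: k => [|k IH].
  by rewrite expr0 subrr mul0r subr0 normr0 mul1r sqr_ge0.
rewrite (_ : _ - _ - _ = (1 + w) * ((1 + w) ^+ k - 1 - k%:R * w) + k%:R * w ^+ 2); last first.
  by rewrite exprS -natr1; ring.
have w3 : `|1 + w| <= 3.
  by apply: le_trans (ler_normD _ _) _; rewrite normr1; lra.
apply: le_trans (norm_leD (norm_leM w3 IH) (lexx _)) _.
rewrite normrM normrX (ger0_norm (ler0n _ k)).
have k4 : k%:R <= 4 ^+ k :> R.
  by rewrite -natrX ler_nat ltnW// ltn_expl.
by have := ler_wpM2r (sqr_ge0 `|w|) k4; rewrite (exprS 4 k); lra.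
Qed.

(* [weight k z] is [z ^+ (2 * k)] except that it is [0] at [z = 0] even when [k = 0].  Thus
   [weight k (x * y) * f (ln (x * y)) = weight k x * weight k y * f (ln x + ln y)] for all
   [x, y >= 0], in spite of the junk value [ln 0 = 0]. *)
Definition weight (k : nat) z : R := if 0 < z then z ^+ (2 * k) else 0.

Lemma weight_ge0 k z : 0 <= weight k z.
Proof. by rewrite /weight; case: ifP => // z0; rewrite exprn_ge0// ltW. Qed.

Lemma weight_le k z : z <= 2 -> weight k z <= 4 ^+ k.
Proof.
rewrite /weight => z2; case: ifP => z0; last by rewrite exprn_ge0.
by rewrite exprM lerXn2r ?nnegrE ?sqr_ge0//; nra.
Qed.

Lemma weightM k y z : 0 <= y -> 0 <= z -> weight k (y * z) = weight k y * weight k z.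
Proof.
move=> y0 z0; rewrite /weight.
have [y1|y1] := ltP 0 y; last by rewrite mul0r ltNge mulr_le0_ge0.
have [z1|z1] := ltP 0 z; first by rewrite mulr_gt0// exprMn.
by rewrite !mulr0 ltNge mulr_ge0_le0.
Qed.

(** * Pointwise expansion in the corner entry *)

Section Expansion.
Variables (k : nat) (a b rho : R).
Hypotheses (rho0 : 0 <= rho) (rhoE : rho ^+ 2 = a ^+ 2 + b ^+ 2) (rho1 : rho <= 1).
(** For the complex number [u = a + i b] of modulus [rho], [z] is [|1 - u|] and [1 + w] is its
    square. *)
Let z := Num.sqrt ((1 - a) ^+ 2 + b ^+ 2).
Let w := - (2 * a) + rho ^+ 2.

Let ar : `|a| <= rho.
Proof. by rewrite -(@ler_pXn2r _ 2) ?nnegrE// real_normK ?num_real// rhoE lerDl sqr_ge0. Qed.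
Let zw : z = Num.sqrt (1 + w).
Proof. by congr Num.sqrt; rewrite /w rhoE; ring. Qed.

Lemma norm1B_le2 : z <= 2.
Proof.
rewrite zw -[leRHS]ger0_norm// -sqrtr_sqr ler_wsqrtr// /w.
have r21 : rho ^+ 2 <= 1 by rewrite exprn_ile1.
have : - 1 <= a by move: (le_trans ar rho1); rewrite ler_norml => /andP[].
lra.
Qed.

Let wr : `|w| <= 5 / 2 * rho \/ 1 / 2 < rho.
Proof.
have [r12|] := leP rho (1 / 2); [left|by right].
move: ar; rewrite /w !ler_norml => /andP[? ?]; apply/andP; split; nra.
Qed.

Let wtE : rho <= 1 / 2 -> weight k z = (1 + w) ^+ k /\ ln z = ln (1 + w) / 2.
Proof.
move=> r12; have w0 : 0 < 1 + w.
  by move: ar; rewrite /w ler_norml => /andP[? ?]; nra.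
rewrite /weight zw sqrtr_gt0 w0 exprM sqr_sqrtr ?ltW//; split => //.
have -> : ln (1 + w) = 2 * ln (Num.sqrt (1 + w)).
  by rewrite -[in LHS](sqr_sqrtr (ltW w0)) lnXn ?sqrtr_gt0// mulr_natl.
by field.
Qed.

(** For [rho <= 1 / 2] this is [pow_taylor2] for [(1 + w) ^+ k]; otherwise the left side is bounded
    and [rho ^+ 2 >= 1 / 4]. The linear term stays explicit because it will integrate to zero. *)
Lemma weight_expansion2 : `|weight k z - 1 + 2 * k%:R * a| <= (8 * 4 ^+ k + 8 * k%:R + 8) * rho ^+ 2.
Proof.
have k0 : 0 <= k%:R :> R by [].
have k4 : 0 <= 4 ^+ k :> R by rewrite exprn_ge0.
have [r12|r12] := leP rho (1 / 2).
  have [-> _] := wtE r12.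
  case: wr => [wr1|]; last by rewrite ltNge r12.
  have w2 : `|w| <= 2 by nra.
  rewrite (_ : (1 + w) ^+ k - 1 + 2 * k%:R * a = ((1 + w) ^+ k - 1 - k%:R * w) + k%:R * rho ^+ 2); last by rewrite /w; ring.
  apply: le_trans (norm_leD (pow_taylor2 k w2) (lexx _)) _.
  rewrite normrM (ger0_norm (sqr_ge0 _)) (ger0_norm k0).
  have : `|w| ^+ 2 <= (5 / 2 * rho) ^+ 2 by rewrite ler_pXn2r ?nnegrE// ?mulr_ge0//.
  move=> /(ler_wpM2l k4); have := mulr_ge0 k4 (sqr_ge0 rho); have := mulr_ge0 k0 (sqr_ge0 rho); have := sqr_ge0 rho.
  nra.
have W1 : `|weight k z| <= 4 ^+ k by rewrite ger0_norm ?weight_ge0// weight_le// norm1B_le2.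
have A1 : `|2 * k%:R * a| <= 2 * k%:R * 1.
  by rewrite !normrM ger0_norm// ger0_norm// ler_wpM2l ?mulr_ge0// (le_trans ar).
apply: le_trans (norm_leD (norm_leD W1 (_ : `|- 1| <= 1)) A1) _; first by rewrite normrN1.
have r2 : 1 / 4 <= rho ^+ 2 by nra.
by nra.
Qed.

(** A product of three expansions: the weight is [1 - 2 k a] to first order, [ln z] is the real part
    of [ln (1 - u)], hence [- a + (b ^+ 2 - a ^+ 2) / 2] to second order, and [G] has derivatives
    [g1], [g2]. The cross term [2 k a ^+ 2] is the drift created by the weight, the source of the
    mean [k log N]. *)
Lemma weight_expansion3 (G : R -> R) (G0 g1 g2 : R) :
  (forall h, 0 <= G h <= 1) -> 0 <= G0 <= 1 -> `|g1| <= 1 -> `|g2| <= 1 ->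
  (forall h, `|G h - G0 - h * g1 - h ^+ 2 / 2 * g2| <= 2 * `|h| ^+ 3) ->
  `|weight k z * (G (ln z) - G0) -
     (g1 * (- a + (b ^+ 2 - a ^+ 2) / 2 + 2 * k%:R * a ^+ 2) + g2 * (a ^+ 2 / 2))|
   <= 100 * 100 * (4 ^+ k + k%:R + 1) * rho ^+ 3.
Proof.
move=> G01 G001 g11 g21 GT.
have k0 : 0 <= k%:R :> R by [].
have k4 : 0 <= 4 ^+ k :> R by rewrite exprn_ge0.
have r30 : 0 <= rho ^+ 3 by rewrite exprn_ge0.
have D1 h : `|G h - G0| <= 1.
  by have /andP[? ?] := G01 h; have /andP[? ?] := G001; rewrite ler_norml; lra.
have a2 : a ^+ 2 <= rho ^+ 2 by rewrite rhoE lerDl sqr_ge0.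
have b2 : b ^+ 2 <= rho ^+ 2 by rewrite rhoE lerDr sqr_ge0.
(* For large [rho] every term is bounded in terms of [k] and [rho ^+ 3 >= 1 / 8], so nothing has to
   be expanded. *)
have [r12|r12] := leP rho (1 / 2); last first.
  have W1 : `|weight k z| <= 4 ^+ k by rewrite ger0_norm ?weight_ge0// weight_le// norm1B_le2.
  have r21 : rho ^+ 2 <= 1 by rewrite exprn_ile1.
  have P1 : `|- a + (b ^+ 2 - a ^+ 2) / 2 + 2 * k%:R * a ^+ 2| <= 2 + 2 * k%:R.
    have ka : k%:R * a ^+ 2 <= k%:R * 1 by rewrite ler_wpM2l// (le_trans a2).
    have ka0 : 0 <= k%:R * a ^+ 2 by rewrite mulr_ge0// sqr_ge0.
    have := sqr_ge0 a; have := sqr_ge0 b.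
    have /andP[] : - 1 <= a <= 1 by rewrite -ler_norml (le_trans ar rho1).
    by rewrite ler_norml => ? ? ? ?; apply/andP; split; lra.
  have P2 : `|a ^+ 2 / 2| <= 1 by rewrite ger0_norm ?divr_ge0 ?sqr_ge0//; lra.
  have := norm_leD (norm_leM g11 P1) (norm_leM g21 P2); rewrite -normrN => P3.
  apply: le_trans (norm_leD (norm_leM W1 (D1 _)) P3) _.
  have r3 : 1 / 8 <= rho ^+ 3.
    have : (1 / 2) ^+ 3 <= rho ^+ 3 by rewrite ler_pXn2r ?nnegrE// ltW.
    by lra.
  by nra.
have [-> lnz] := wtE r12.
case: wr => [wr1|]; last by rewrite ltNge r12.
have w2 : `|w| <= 2 by nra.
have w34 : - (3 / 4) <= w by move: ar; rewrite /w ler_norml => /andP[? ?]; nra.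
have R0 : 0 <= rho by exact: rho0.
have r2 : rho ^+ 2 <= rho / 2 by rewrite expr2 ler_wpM2l//; lra.
have r3 : rho ^+ 3 <= rho ^+ 2 / 2 by rewrite exprSr ler_wpM2l ?sqr_ge0//; lra.
have w3r : `|w| ^+ 3 <= 16 * rho ^+ 3.
  have : `|w| ^+ 3 <= (5 / 2 * rho) ^+ 3 by rewrite ler_pXn2r ?nnegrE// ?mulr_ge0//.
  by rewrite exprMn; lra.
pose X := ln z; pose X0 := - a + (b ^+ 2 - a ^+ 2) / 2.
have XX0 : `|X - X0| <= 34 * rho ^+ 3.
  have L := ln1D_taylor3 w34.
  rewrite /X lnz (_ : _ - X0 = (ln (1 + w) - w + w ^+ 2 / 2) / 2 + (a * rho ^+ 2 - rho ^+ 4 / 4)); last first.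
    have b2E : b ^+ 2 = rho ^+ 2 - a ^+ 2 by rewrite rhoE; ring.
    by rewrite /X0 /w b2E; field.
  have L2 : `|(ln (1 + w) - w + w ^+ 2 / 2) / 2| <= 32 * rho ^+ 3.
    by rewrite normrM [`|2^-1|]ger0_norm ?invr_ge0//; lra.
  have L3 : `|a * rho ^+ 2 - rho ^+ 4 / 4| <= 2 * rho ^+ 3.
    have A1 : `|a * rho ^+ 2| <= rho ^+ 3.
      by rewrite normrM [`|rho ^+ 2|]ger0_norm ?sqr_ge0// exprS ler_wpM2r ?sqr_ge0.
    have A2 : `|- (rho ^+ 4 / 4)| <= rho ^+ 3.
      by rewrite normrN ger0_norm ?divr_ge0 ?exprn_ge0// exprSr; nra.
    by apply: le_trans (norm_leD A1 A2) _; lra.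
  by apply: le_trans (norm_leD L2 L3) _; lra.
have Xa : `|X + a| <= 18 * rho ^+ 2.
  rewrite (_ : X + a = (X - X0) + (b ^+ 2 - a ^+ 2) / 2); last by rewrite /X0; ring.
  have B1 : `|(b ^+ 2 - a ^+ 2) / 2| <= rho ^+ 2.
    by have := sqr_ge0 a; have := sqr_ge0 b; rewrite ler_norml => ? ?; lra.
  by apply: le_trans (norm_leD XX0 B1) _; lra.
have Xr : `|X| <= 10 * rho.
  rewrite -[X](addrK a); apply: le_trans (norm_leD Xa (_ : `|- a| <= rho)) _.
    by rewrite normrN.
  by lra.
have X2 : X ^+ 2 <= 100 * rho ^+ 2.
  rewrite -real_normK ?num_real//.
  have : `|X| ^+ 2 <= (10 * rho) ^+ 2 by rewrite ler_pXn2r ?nnegrE// ?mulr_ge0//.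
  by rewrite exprMn; lra.
have X3 : `|X| ^+ 3 <= 1000 * rho ^+ 3.
  have : `|X| ^+ 3 <= (10 * rho) ^+ 3 by rewrite ler_pXn2r ?nnegrE// ?mulr_ge0//.
  by rewrite exprMn; lra.
pose D := G X - G0.
have T := GT X; rewrite -/D in T.
have T1 : `|D - X * g1| <= 1050 * rho ^+ 2.
  rewrite (_ : D - _ = (D - X * g1 - X ^+ 2 / 2 * g2) + X ^+ 2 / 2 * g2); last by ring.
  have B1 : `|X ^+ 2 / 2| <= 50 * rho ^+ 2 by rewrite ger0_norm ?divr_ge0 ?sqr_ge0//; lra.
  by apply: le_trans (norm_leD T (norm_leM B1 g21)) _; lra.
have T0 : `|D| <= 535 * rho.
  rewrite -[D](subrK (X * g1)); apply: le_trans (norm_leD T1 (norm_leM Xr g11)) _; lra.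
pose ek := (1 + w) ^+ k - 1 - k%:R * w.
have Ek : `|ek| <= 4 ^+ k * (25 / 4 * rho ^+ 2).
  apply: le_trans (pow_taylor2 k w2) _; rewrite ler_wpM2l//.
  have : `|w| ^+ 2 <= (5 / 2 * rho) ^+ 2 by rewrite ler_pXn2r ?nnegrE// ?mulr_ge0//.
  by rewrite exprMn; lra.
have kk : `|k%:R| <= k%:R :> R by rewrite ger0_norm.
have wX : `|w * X - 2 * a ^+ 2| <= 46 * rho ^+ 3.
  rewrite (_ : _ - _ = w * (X + a) + - (a * rho ^+ 2)); last by rewrite /w; ring.
  have A1 : `|- (a * rho ^+ 2)| <= rho ^+ 3.
    by rewrite normrN normrM [`|rho ^+ 2|]ger0_norm ?sqr_ge0// exprS ler_wpM2r ?sqr_ge0.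
  by apply: le_trans (norm_leD (norm_leM wr1 Xa) A1) _; rewrite (exprS rho 2); nra.
have XmA : `|X - a| <= 11 * rho.
  by apply: le_trans (norm_leD Xr (_ : `|- a| <= rho)) _; rewrite ?normrN//; lra.
(* Each of the six products is of third order, because [w] is close to [- 2 a], [X] to [- a], and
   [D] to [X * g1]. *)
rewrite -/X -/D (_ : _ - _ = ek * D + k%:R * (w * (D - X * g1)) + k%:R * ((w * X - 2 * a ^+ 2) * g1)
  + (D - X * g1 - X ^+ 2 / 2 * g2) + (X - X0) * g1 + ((X + a) * (X - a)) * (g2 / 2)); last first.
  by rewrite /ek /X0; field.
have g22 : `|g2 / 2| <= 1 by rewrite normrM [`|2^-1|]ger0_norm ?invr_ge0//; lra.
apply: le_trans (norm_leD (norm_leD (norm_leD (norm_leD (norm_leD (norm_leM Ek T0)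
  (norm_leM kk (norm_leM wr1 T1))) (norm_leM kk (norm_leM wX g11))) T) (norm_leM XX0 g11))
  (norm_leM (norm_leM Xa XmA) g22)) _.
have -> : 4 ^+ k * (25 / 4 * rho ^+ 2) * (535 * rho) = (25 / 4 * 535) * (4 ^+ k * rho ^+ 3) by ring.
have -> : k%:R * (5 / 2 * rho * (1050 * rho ^+ 2)) = (5 / 2 * 1050) * (k%:R * rho ^+ 3) by ring.
have -> : k%:R * (46 * rho ^+ 3 * 1) = 46 * (k%:R * rho ^+ 3) by ring.
have -> : 18 * rho ^+ 2 * (11 * rho) * 1 = 198 * rho ^+ 3 by ring.
have := mulr_ge0 k4 r30; have := mulr_ge0 k0 r30.
by lra.
Qed.
End Expansion.
End Heat.

(** * One Lindeberg step for an abstract corner law *)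

Section Step.
Variable R : realType.

Lemma measurable_weight k : measurable_fun setT (@weight R k).
Proof.
rewrite /weight; apply: measurable_fun_ifT => //.
by apply: measurable_fun_ltr.
Qed.

Lemma measurable_sqrt : measurable_fun setT (@Num.sqrt R).
Proof. by apply: continuous_measurable_fun; exact: sqrt_continuous. Qed.

Section Integrals.
Context (d : measure_display) (T : measurableType d).
Variables (P : probability T R) (D : set T).
Hypotheses (mD : measurable D) (PD : P D = 1%E).
Implicit Types (f g : T -> R).

Lemma integrable_bounded f (M : R) : measurable_fun D f ->
  (forall x, D x -> `|f x| <= M) -> P.-integrable D (EFin \o f).
Proof.
move=> mf fM; apply: measurable_bounded_integrable => //.
  by rewrite -ge0_fin_numE// fin_num_measure.
exists M; split; rewrite ?num_real// => y My x Dx.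
exact: le_trans (fM x Dx) (ltW My).
Qed.

Lemma norm_Rintegral_le f g : P.-integrable D (EFin \o f) -> P.-integrable D (EFin \o g) ->
  (forall x, D x -> `|f x| <= g x) -> `|\int[P]_(x in D) f x| <= \int[P]_(x in D) g x.
Proof.
move=> fi gi fg; apply: le_trans (le_normr_Rintegral mD fi) _.
apply: le_Rintegral => //.
exact: (integrable_norm fi).
Qed.

Lemma Rintegral_cst1 (r : R) : \int[P]_(_ in D) r = r.
Proof. by rewrite Rintegral_cst// (_ : _ D = 1%E) ?mulr1//; exact: PD. Qed.

Lemma integrableZ f (r : R) : P.-integrable D (EFin \o f) ->
  P.-integrable D (EFin \o (fun x => r * f x)).
Proof. by move=> fi; have := integrableZl mD r fi; apply: eq_integrable. Qed.

Lemma integrable_addf f g : P.-integrable D (EFin \o f) -> P.-integrable D (EFin \o g) ->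
  P.-integrable D (EFin \o (fun x => f x + g x)).
Proof. by move=> fi gi; have := integrableD mD fi gi; apply: eq_integrable. Qed.

Lemma integrable_diff f g : P.-integrable D (EFin \o f) -> P.-integrable D (EFin \o g) ->
  P.-integrable D (EFin \o (fun x => f x - g x)).
Proof. by move=> fi gi; have := integrableB mD fi gi; apply: eq_integrable. Qed.

Lemma integrable_const (r : R) : P.-integrable D (EFin \o (fun=> r)).
Proof. by apply: (@integrable_bounded _ `|r|). Qed.
End Integrals.

Definition mass_const k : R := 8 * 4 ^+ k + 8 * k%:R + 8.
(** The three summands come from the pointwise expansion integrated against [rho ^+ 3], from the
    mismatch between [1 / N] and [l] times the mass, and from [heat_step], where [l <= 3 / N] gives
    the 9 and the mass bound gives [4 ^+ k]. *)
Definition step_const k : R := 150 * 100 * (4 ^+ k + k%:R + 1) + (4 + 3 * mass_const k) * (k%:R + 1)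
  + 9 * 4 ^+ k * (k%:R ^+ 2 + 2 * k%:R + 6).

Lemma mass_const_ge0 k : 0 <= mass_const k.
Proof. by rewrite /mass_const !addr_ge0// mulr_ge0// exprn_ge0. Qed.

Section StepBound.
Context (d : measure_display) (T : measurableType d).
Variables (P : probability T R) (D : set T) (a b : T -> R) (N k : nat).
Hypotheses (mD : measurable D) (PD : P D = 1%E).
Hypotheses (ma : measurable_fun D a) (mb : measurable_fun D b).
Hypothesis ab1 : forall x, D x -> a x ^+ 2 + b x ^+ 2 <= 1.
Hypothesis N3 : (3 <= N)%N.
Local Notation "\E f" := (\int[P]_(x in D) f x) (at level 10).
Hypotheses (Ea : \E a = 0) (Ea2 : \E (fun x => a x ^+ 2) = (2 * N%:R)^-1)
  (Eb2 : \E (fun x => b x ^+ 2) = (2 * N%:R)^-1)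
  (E4 : \E (fun x => (a x ^+ 2 + b x ^+ 2) ^+ 2) <= 2 / N%:R ^+ 2).

Let z x := Num.sqrt ((1 - a x) ^+ 2 + b x ^+ 2).
Let rho x := Num.sqrt (a x ^+ 2 + b x ^+ 2).
Let Nr : R := N%:R.
Let s := Num.sqrt Nr.
Let N0 : 0 < Nr. Proof. by rewrite ltr0n (leq_trans _ N3). Qed.
Let N3r : 3 <= Nr. Proof. by rewrite ler_nat. Qed.
Let s0 : 0 < s. Proof. by rewrite sqrtr_gt0. Qed.
Let s2 : s ^+ 2 = Nr. Proof. by rewrite sqr_sqrtr// ltW. Qed.

Let rho2 x : rho x ^+ 2 = a x ^+ 2 + b x ^+ 2.
Proof. by rewrite sqr_sqrtr// addr_ge0 ?sqr_ge0. Qed.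
Let rho0 x : 0 <= rho x. Proof. exact: sqrtr_ge0. Qed.
Let rho1 x : D x -> rho x <= 1.
Proof. by move=> Dx; rewrite -sqrtr1 ler_wsqrtr// ab1. Qed.
Let mrho : measurable_fun D rho.
Proof.
apply: measurableT_comp; first exact: measurable_sqrt.
by apply: measurable_funD; apply: measurable_funX.
Qed.
Let mz : measurable_fun D z.
Proof.
apply: measurableT_comp; first exact: measurable_sqrt.
apply: measurable_funD; apply: measurable_funX => //.
exact: measurable_funB.
Qed.
Let a1 x : D x -> `|a x| <= 1.
Proof.
move=> /ab1 H; rewrite -(@expr_le1 _ 2)// real_normK ?num_real//.
by rewrite (le_trans _ H)// lerDl sqr_ge0.
Qed.
Let b1 x : D x -> `|b x| <= 1.
Proof.
move=> /ab1 H; rewrite -(@expr_le1 _ 2)// real_normK ?num_real//.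
by rewrite (le_trans _ H)// lerDr sqr_ge0.
Qed.
Let ia : P.-integrable D (EFin \o a).
Proof. exact: integrable_bounded a1. Qed.
Let ia2 : P.-integrable D (EFin \o (fun x => a x ^+ 2)).
Proof.
apply: (@integrable_bounded _ _ _ _ mD _ 1); first exact: measurable_funX.
by move=> x /a1 H; rewrite normrX exprn_ile1.
Qed.
Let ib2 : P.-integrable D (EFin \o (fun x => b x ^+ 2)).
Proof.
apply: (@integrable_bounded _ _ _ _ mD _ 1); first exact: measurable_funX.
by move=> x /b1 H; rewrite normrX exprn_ile1.
Qed.
Let irho n : P.-integrable D (EFin \o (fun x => rho x ^+ n)).
Proof.
apply: (@integrable_bounded _ _ _ _ mD _ 1); first exact: measurable_funX.
by move=> x /rho1 H; rewrite ger0_norm ?exprn_ge0// exprn_ile1.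
Qed.
Let iwt : P.-integrable D (EFin \o (fun x => weight k (z x))).
Proof.
apply: (@integrable_bounded _ _ _ _ mD _ (4 ^+ k)).
  by apply: (measurableT_comp (measurable_weight k)).
move=> x Dx; rewrite ger0_norm ?weight_ge0// weight_le//.
exact: (norm1B_le2 (rho0 x) (rho2 x) (rho1 Dx)).
Qed.

Let Erho2 : \E (fun x => rho x ^+ 2) = Nr^-1.
Proof.
under eq_Rintegral do rewrite rho2.
by rewrite RintegralD// Ea2 Eb2 -/Nr; field; rewrite gt_eqF.
Qed.

(** Interpolation between the second and fourth moments by the arithmetic-geometric mean inequality;
    the weight [s = sqrt N] balances the two, since [rho] is typically of size [1 / s]. *)
Let Erho3 : \E (fun x => rho x ^+ 3) <= 3 / 2 / (Nr * s).
Proof.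
have i2 : P.-integrable D (EFin \o (fun x => (2 * s)^-1 * rho x ^+ 2)).
  by apply: integrableZ => //; exact: irho.
have i4 : P.-integrable D (EFin \o (fun x => (s / 2) * rho x ^+ 4)).
  by apply: integrableZ => //; exact: irho.
have : \E (fun x => rho x ^+ 3) <= \E (fun x => (2 * s)^-1 * rho x ^+ 2 + (s / 2) * rho x ^+ 4).
  apply: le_Rintegral => //.
    exact: integrable_addf.
  move=> x _; rewrite -subr_ge0.
  rewrite (_ : _ - _ = (2 * s)^-1 * (rho x ^+ 2 * (1 - s * rho x) ^+ 2)); last first.
    by field; rewrite gt_eqF.
  apply: mulr_ge0; first by rewrite invr_ge0 mulr_ge0// ltW.
  by apply: mulr_ge0; exact: sqr_ge0.
move/le_trans; apply.
rewrite RintegralD// !RintegralZl// Erho2.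
have : \E (fun x => rho x ^+ 4) <= 2 / Nr ^+ 2.
  by under eq_Rintegral do rewrite (exprM _ 2 2) rho2.
have s20 : 0 <= s / 2 by rewrite divr_ge0// ltW.
move/(ler_wpM2l s20) => H.
apply: le_trans (lerD (lexx _) H) _.
by rewrite -s2 le_eqVlt; apply/orP; left; apply/eqP; field; rewrite gt_eqF.
Qed.

Lemma mass_bound : `|\E (fun x => weight k (z x)) - 1| <= mass_const k / Nr.
Proof.
have i2 : P.-integrable D (EFin \o (fun x => 2 * k%:R * a x)) by exact: integrableZ.
have i1 : P.-integrable D (EFin \o (fun x => weight k (z x) - 1)).
  by apply: integrable_diff => //; exact: integrable_const.
(* Adding the linear term changes nothing, as [a] has mean zero, and it makes the integrand
   quadratically small. *)
have <- : \E (fun x => weight k (z x) - 1 + 2 * k%:R * a x) = \E (fun x => weight k (z x)) - 1.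
  rewrite RintegralD// RintegralZl// Ea mulr0 addr0 RintegralB// ?Rintegral_cst1//.
  exact: integrable_const.
rewrite -Erho2 -RintegralZl//.
apply: norm_Rintegral_le => //.
- exact: integrable_addf.
- by apply: integrableZ => //; exact: irho.
- by move=> x Dx; exact: (weight_expansion2 _ (rho0 x) (rho2 x) (rho1 Dx)).
Qed.

(** Both sides agree up to the error with [p * G0 + (k g1 + g2 / 4) / N], where [p] is the mass,
    [G0] the unperturbed value, and [g1], [g2] the derivatives of the test function. Keeping [p] as
    a factor of the Gaussian side lets the step be normalised afterwards. *)
Lemma step_bound (sg e : R) (l := ln Nr - ln (Nr - 1)) : 1 <= sg ->
  `|\E (fun x => weight k (z x) * gauss_tail ((e - ln (z x)) / sg)) -
    \E (fun x => weight k (z x)) * gauss_tail ((e - k%:R * l) / Num.sqrt (sg ^+ 2 + l / 2))|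
  <= step_const k / (Nr * s).
Proof.
move=> sg1.
have sg0 : 0 < sg by lra.
have N3' : 3 <= Nr by exact: N3r.
pose G h := gauss_tail ((e - h) / sg); pose G0 := gauss_tail (e / sg).
pose g1 := gauss_dens (e / sg) / sg; pose g2 := e / sg * gauss_dens (e / sg) / sg ^+ 2.
have G01 h : 0 <= G h <= 1 by rewrite gauss_tail_ge0 gauss_tail_le1.
have G00 : 0 <= G0 <= 1 by rewrite gauss_tail_ge0 gauss_tail_le1.
have sgV : `|sg^-1| <= 1 by rewrite ger0_norm ?invr_ge0 ?(ltW sg0)// invf_le1.
have sgV2 : `|(sg ^+ 2)^-1| <= 1 by rewrite -exprVn normrX exprn_ile1.
have g11 : `|g1| <= 1 by rewrite -[leRHS]mulr1; exact: norm_leM (gauss_dens_ub1 _) sgV.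
have g21 : `|g2| <= 1 by rewrite -[leRHS]mulr1; exact: norm_leM (xgauss_dens_ub _) sgV2.
have GT h : `|G h - G0 - h * g1 - h ^+ 2 / 2 * g2| <= 2 * `|h| ^+ 3.
  have := gauss_tail_taylor3 (e / sg) (h / sg).
  rewrite -mulrBl -/(G h) -/G0 -mulrA -[h / sg * _]mulrA [sg^-1 * gauss_dens _]mulrC -/g1.
  rewrite (_ : (h / sg) ^+ 2 * _ = h ^+ 2 / 2 * g2); last first.
    by rewrite /g2; field; rewrite gt_eqF.
  move/le_trans; apply; rewrite normrM exprMn ler_wpM2l// ler_piMr ?exprn_ge0//.
  by rewrite exprn_ile1.
have mG : measurable_fun D (fun x => G (ln (z x))).
  apply: (measurableT_comp (@measurable_gauss_tail R)).
  apply: measurable_funM => //; apply: measurable_funB => //.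
  exact: (measurableT_comp (@measurable_ln R)).
have mw : measurable_fun D (fun x => weight k (z x)).
  by apply: (measurableT_comp (measurable_weight k)).
have w4 x : D x -> `|weight k (z x)| <= 4 ^+ k.
  move=> Dx; rewrite ger0_norm ?weight_ge0// weight_le//.
  exact: (norm1B_le2 (rho0 x) (rho2 x) (rho1 Dx)).
have iH : P.-integrable D (EFin \o (fun x => weight k (z x) * (G (ln (z x)) - G0))).
  apply: (@integrable_bounded _ _ _ _ mD _ (4 ^+ k * 1)).
    by apply: measurable_funM => //; exact: measurable_funB.
  move=> x Dx; apply: norm_leM; first exact: w4.
  have /andP[? ?] := G01 (ln (z x)).
  by move: G00 => /andP[? ?]; rewrite ler_norml; lra.
pose Pol x := g1 * (- a x + (b x ^+ 2 - a x ^+ 2) / 2 + 2 * k%:R * a x ^+ 2) + g2 * (a x ^+ 2 / 2).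
pose c1 := (2 * k%:R - 1 / 2) * g1 + g2 / 2.
have PolE : Pol = fun x => (- g1) * a x + g1 / 2 * b x ^+ 2 + c1 * a x ^+ 2.
  by apply/funext => x; rewrite /Pol /c1; field.
have j1 : P.-integrable D (EFin \o (fun x => (- g1) * a x)) by exact: integrableZ.
have j2 : P.-integrable D (EFin \o (fun x => g1 / 2 * b x ^+ 2)) by exact: integrableZ.
have j3 : P.-integrable D (EFin \o (fun x => c1 * a x ^+ 2)) by exact: integrableZ.
have j12 : P.-integrable D (EFin \o (fun x => (- g1) * a x + g1 / 2 * b x ^+ 2)) by exact: integrable_addf.
have iP : P.-integrable D (EFin \o Pol) by rewrite PolE; exact: integrable_addf.
have EP : \E Pol = (k%:R * g1 + g2 / 4) / Nr.
  rewrite PolE !RintegralD// !RintegralZl// Ea Ea2 Eb2 -/Nr /c1.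
  by field; rewrite gt_eqF.
have HP : `|\E (fun x => weight k (z x) * (G (ln (z x)) - G0)) - \E Pol| <=
    150 * 100 * (4 ^+ k + k%:R + 1) / (Nr * s).
  rewrite -RintegralB//.
  apply: (@le_trans _ _ (\E (fun x => 100 * 100 * (4 ^+ k + k%:R + 1) * rho x ^+ 3))).
    apply: norm_Rintegral_le => //.
    - exact: integrable_diff.
    - by apply: integrableZ => //; exact: irho.
    move=> x Dx; apply: (weight_expansion3 _ (rho0 x) (rho2 x) (rho1 Dx)) => //.
  rewrite RintegralZl//.
  have C0 : 0 <= 100 * 100 * (4 ^+ k + k%:R + 1) :> R by rewrite !mulr_ge0// !addr_ge0// exprn_ge0.
  apply: le_trans (ler_wpM2l C0 Erho3) _.
  by rewrite le_eqVlt; apply/orP; left; apply/eqP; field; rewrite !gt_eqF.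
pose p := \E (fun x => weight k (z x)).
have EG : \E (fun x => weight k (z x) * G (ln (z x))) =
    \E (fun x => weight k (z x) * (G (ln (z x)) - G0)) + p * G0.
  rewrite /p -RintegralZr// -RintegralD//.
    by apply: eq_Rintegral => x _; ring.
  by rewrite (_ : (fun x => _) = (fun x => G0 * weight k (z x)));
    [exact: integrableZ|apply/funext => x; rewrite mulrC].
have lN : `|l - Nr^-1| <= 4 / Nr ^+ 2.
  have NV : Nr^-1 <= 1 / 3 by rewrite div1r lef_pV2 ?posrE.
  have NV0 : 0 < Nr^-1 by rewrite invr_gt0.
  have := @ln1D_taylor2 R (- Nr^-1).
  rewrite (_ : - (3 / 4) <= _); last by lra.
  move=> /(_ isT); rewrite opprK normrN (ger0_norm (ltW NV0)) exprVn.
  rewrite (_ : 1 - Nr^-1 = (Nr - 1) / Nr); last by field; rewrite gt_eqF.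
  have N10 : 0 < Nr - 1 by rewrite subr_gt0 (lt_le_trans _ N3r)// ltr1n.
  rewrite ln_div ?posrE//.
  by rewrite -normrN /l; congr (`|_| <= _); ring.
have l0 : 0 <= l by rewrite subr_ge0 ler_ln ?posrE//; lra.
have NV2 : 4 / Nr ^+ 2 <= 4 / 3 / Nr.
  rewrite expr2 invfM mulrA ler_wpM2r ?invr_ge0 ?(ltW N0)//.
  by rewrite ler_pdivrMr//; lra.
(* From [3 <= N]; together with it this bound gives [l <= 1], as [heat_step] requires. *)
have l3 : l <= 3 / Nr.
  have NV0 : 0 < Nr^-1 by rewrite invr_gt0.
  move: lN; rewrite ler_norml => /andP[_ H]; lra.
have l1 : 0 <= l <= 1.
  by rewrite l0 (le_trans l3)// ler_pdivrMr// mul1r.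
have HS := heat_step k e sg1 l1; rewrite -/G0 -/g1 -/g2 in HS.
set Q' := gauss_tail _ in HS *.
pose th := Q' - G0 - k%:R * l * g1 - l / 4 * g2.
rewrite -/th in HS.
have p4 : `|p| <= 4 ^+ k.
  rewrite -(Rintegral_cst1 mD PD (4 ^+ k)); apply: norm_Rintegral_le => //.
  exact: integrable_const.
have PB : `|p - 1| <= mass_const k / Nr := mass_bound.
have l3n : `|l| <= 3 / Nr by rewrite ger0_norm.
have N1pl : `|Nr^-1 - p * l| <= (4 + 3 * mass_const k) / Nr ^+ 2.
  rewrite (_ : _ - _ = - (l - Nr^-1) - (p - 1) * l); last by ring.
  apply: le_trans (norm_leD (_ : _ <= 4 / Nr ^+ 2) (_ : _ <= mass_const k / Nr * (3 / Nr))) _.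
  - by rewrite normrN.
  - by rewrite normrN; exact: norm_leM.
  by rewrite le_eqVlt; apply/orP; left; apply/eqP; field; rewrite !gt_eqF.
have kg : `|k%:R * g1 + g2 / 4| <= k%:R + 1.
  apply: norm_leD.
    by rewrite normrM ger0_norm// ler_piMr.
  by rewrite normrM [`|4^-1|]ger0_norm ?invr_ge0//; lra.
have cth : `|th| <= (k%:R ^+ 2 + 2 * k%:R + 6) * (9 / Nr ^+ 2).
  apply: le_trans HS _; rewrite ler_wpM2l ?addr_ge0 ?sqr_ge0 ?mulr_ge0//.
  have : l ^+ 2 <= (3 / Nr) ^+ 2 by rewrite lerXn2r ?nnegrE// divr_ge0// (ltW N0).
  by rewrite expr_div_n; lra.
rewrite -/(G _) EG -/p.
(* The zeroth-order terms [p * G0] cancel; what remains is the expansion error, the mismatch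
   [1 / N - p * l], and the error [th] of the heat step. *)
rewrite (_ : _ - p * Q' = (\E (fun x => weight k (z x) * (G (ln (z x)) - G0)) - \E Pol) +
  (Nr^-1 - p * l) * (k%:R * g1 + g2 / 4) - p * th); last first.
  by rewrite EP /th; field; rewrite gt_eqF.
apply: le_trans (norm_leD (norm_leD HP (norm_leM N1pl kg)) (_ : _ <= 4 ^+ k * ((k%:R ^+ 2 + 2 * k%:R + 6) * (9 / Nr ^+ 2)))) _.
  by rewrite normrN; exact: norm_leM.
have NN : (Nr ^+ 2)^-1 <= (Nr * s)^-1.
  rewrite lef_pV2 ?posrE ?exprn_gt0 ?mulr_gt0// expr2 ler_wpM2l ?(ltW N0)//.
  by rewrite -s2 expr2 ler_peMl ?(ltW s0)// -sqrtr1 ler_wsqrtr//; lra.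
have c0 : 0 <= (4 + 3 * mass_const k) * (k%:R + 1).
  by rewrite mulr_ge0 ?addr_ge0// mulr_ge0// mass_const_ge0.
have c0' : 0 <= 9 * 4 ^+ k * (k%:R ^+ 2 + 2 * k%:R + 6) :> R.
  by rewrite !mulr_ge0 ?exprn_ge0// !addr_ge0 ?sqr_ge0// mulr_ge0.
have := ler_wpM2l c0 NN; have := ler_wpM2l c0' NN.
by rewrite /step_const; lra.
Qed.
End StepBound.
End Step.

(** * Unitary matrices and Haar measure *)

Section UnitaryAlgebra.
Variable R : realType.
Local Notation C := R[i].

(** Rectangular form of [adjmx], with which it agrees by conversion on square matrices; rows and
    blocks need it. *)
Definition cadj m n (A : 'M[C]_(m, n)) : 'M[C]_(n, m) := (map_mx (@conjc R) A)^T.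

Lemma cadjM m n p (A : 'M[C]_(m, n)) (B : 'M[C]_(n, p)) : cadj (A *m B) = cadj B *m cadj A.
Proof. by rewrite /cadj map_mxM trmx_mul. Qed.

Lemma cadjD m n (A B : 'M[C]_(m, n)) : cadj (A + B) = cadj A + cadj B.
Proof. by rewrite /cadj map_mxD linearD. Qed.

Lemma cadjZ m n (c : C) (A : 'M[C]_(m, n)) : cadj (c *: A) = conjc c *: cadj A.
Proof. by rewrite /cadj map_mxZ linearZ. Qed.

Lemma cadjK m n (A : 'M[C]_(m, n)) : cadj (cadj A) = A.
Proof. by apply/matrixP => i j; rewrite !mxE conjcK. Qed.

Lemma cadj_scalar n (c : C) : cadj (c%:M : 'M[C]_n) = (conjc c)%:M.
Proof. by rewrite /cadj map_scalar_mx tr_scalar_mx. Qed.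

Lemma cadj_block m1 m2 n1 n2 (A : 'M[C]_(m1, n1)) (B : 'M[C]_(m1, n2))
    (E : 'M[C]_(m2, n1)) (F : 'M[C]_(m2, n2)) :
  cadj (block_mx A B E F) = block_mx (cadj A) (cadj E) (cadj B) (cadj F).
Proof. by rewrite /cadj map_block_mx tr_block_mx. Qed.

Lemma cadj_self_eq0 m n (A : 'M[C]_(m, n)) : cadj A *m A = 0 -> A = 0.
Proof.
move=> AA; apply/matrixP => i j; rewrite [RHS]mxE.
have := congr1 (fun M : 'M[C]_n => complex.Re (M j j)) AA.
rewrite !mxE raddf_sum/= => /eqP; rewrite psumr_eq0.
  move=> /allP/(_ i); rewrite mem_index_enum => /(_ isT).
  rewrite !mxE; case: (A i j) => x y /=.
  rewrite mulNr opprK => /eqP h.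
  have /eqP : x ^+ 2 + y ^+ 2 = 0 by rewrite -h; ring.
  by rewrite paddr_eq0 ?sqr_ge0// !sqrf_eq0 => /andP[/eqP -> /eqP ->].
move=> k _; rewrite !mxE; case: (A k j) => x y /=.
by rewrite mulNr opprK; apply: addr_ge0; rewrite -expr2 sqr_ge0.
Qed.

Lemma unitary_mxP n (U : 'M[C]_n) : unitary_mx U <-> cadj U *m U = 1%:M.
Proof. by []. Qed.

Lemma unitary_mulmxV n (U : 'M[C]_n) : unitary_mx U -> U *m cadj U = 1%:M.
Proof. by move=> /mulmx1C. Qed.

Lemma unitary_adj n (U : 'M[C]_n) : unitary_mx U -> unitary_mx (cadj U).
Proof. by move=> /unitary_mulmxV; rewrite unitary_mxP cadjK. Qed.

Lemma unitaryM n (U V : 'M[C]_n) : unitary_mx U -> unitary_mx V -> unitary_mx (U *m V).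
Proof.
move=> /unitary_mxP hU /unitary_mxP hV; apply/unitary_mxP.
by rewrite cadjM mulmxA -[_ *m cadj U *m U]mulmxA hU mulmx1.
Qed.

Lemma unitary_unit n (U : 'M[C]_n) : unitary_mx U -> U \in unitmx.
Proof. by move=> /mulmx1_unit[]. Qed.

Lemma unitary_scalar n (c : C) : conjc c * c = 1 -> unitary_mx (c%:M : 'M[C]_n).
Proof. by move=> c1; apply/unitary_mxP; rewrite cadj_scalar -scalar_mxM c1. Qed.

Lemma unitary_block n (U : 'M[C]_n) :
  unitary_mx U -> unitary_mx (block_mx (1%:M : 'M[C]_1) 0 0 U : 'M[C]_(1 + n)).
Proof.
move=> /unitary_mxP hU; apply/unitary_mxP.
rewrite cadj_block mulmx_block hU cadj_scalar conjc1 !mulmx0.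
rewrite /cadj !map_mx0 !trmx0 !mul0mx !addr0 !add0r mulmx1.
by rewrite -scalar_mx_block.
Qed.

(** Both sides times [\det A] equal the determinant of [A - A *m B *m A]. *)
Lemma det_1BMC n (A B : 'M[C]_n) : A \in unitmx -> \det (1%:M - A *m B) = \det (1%:M - B *m A).
Proof.
move=> uA.
have dA : \det A != 0 by rewrite -unitfE -unitmxE.
apply: (mulIf dA); rewrite -det_mulmx [RHS]mulrC -det_mulmx.
by rewrite mulmxBl mulmxBr mul1mx mulmx1 mulmxA.
Qed.

Lemma conjc1Bneq0 (a : C) : 1 - a != 0 -> 1 - conjc a != 0.
Proof.
by rewrite -conjc_eq0 rmorphB rmorph1.
Qed.

(* The Schur complement of the corner entry [1 - a] of [1 - U], re-expressed as [1 - W]. *)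
Lemma unitary_schur n (U : 'M[C]_(1 + n)) : unitary_mx U ->
  exists2 W : 'M[C]_n, unitary_mx W & forall U' : 'M[C]_n, unitary_mx U' ->
    \det (1%:M - block_mx (1%:M : 'M[C]_1) 0 0 U' *m U) =
    (1 - U 0 0) * \det (1%:M - W *m U').
Proof.
move=> /unitary_mxP hU.
pose a := U 0 0.
pose A := ulsubmx U; pose b := ursubmx U; pose c := dlsubmx U; pose D := drsubmx U.
have AE : A = a%:M by rewrite [A]mx11_scalar; congr (_%:M); rewrite !mxE; congr (U _ _); apply/val_inj.
have UE : U = block_mx a%:M b c D by rewrite -AE submxK.
have : cadj (block_mx a%:M b c D) *m block_mx a%:M b c D = block_mx 1%:M 0 0 1%:M.
  by rewrite -UE -scalar_mx_block.
rewrite cadj_block mulmx_block cadj_scalar => /eq_block_mx[E1 E2 E3 E4].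
have cc : cadj c *m c = (1 - conjc a * a)%:M.
  by rewrite -scalar_mxM in E1; rewrite raddfB/= -E1 addrAC subrr add0r.
have cD : cadj c *m D = - (conjc a *: b).
  by rewrite mul_scalar_mx in E2; apply/eqP; rewrite -addr_eq0 addrC E2.
have Dc : cadj D *m c = - (a *: cadj b).
  by rewrite mul_mx_scalar in E3; apply/eqP; rewrite -addr_eq0 addrC E3.
have DD : cadj D *m D = 1%:M - cadj b *m b by rewrite -E4 addrAC subrr add0r.
have diagU U' : block_mx (1%:M : 'M[C]_1) 0 0 U' *m block_mx a%:M b c D =
    block_mx a%:M b (U' *m c) (U' *m D).
  by rewrite mulmx_block !mul1mx !mul0mx !addr0 !add0r.
(* A corner entry 1 exhausts the norm of its column, so [c] and [b] vanish, the matrix is block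
   diagonal, and both determinants are zero once multiplied out. *)
have [a1|a1] := eqVneq (1 - a) 0.
  have aE : a = 1 by apply/esym/subr0_eq.
  have c0 : c = 0.
    have : cadj c *m c = 0 by rewrite cc aE conjc1 mulr1 subrr raddf0.
    exact: cadj_self_eq0.
  have b0 : b = 0.
    move: cD; rewrite c0 /cadj map_mx0 trmx0 mul0mx aE conjc1 scale1r => /eqP.
    by rewrite eq_sym oppr_eq0 => /eqP.
  exists D.
    by apply/unitary_mxP; rewrite DD b0 mulmx0 subr0.
  move=> U' _; rewrite -/a a1 mul0r UE diagU c0 mulmx0 b0.
  rewrite [1%:M]scalar_mx_block opp_block_mx add_block_mx !subr0 aE subrr.
  by rewrite det_lblock det0 ?mul0r.
have a1' := conjc1Bneq0 a1.
pose W := D + (1 - a)^-1 *: (c *m b).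
have cK : conjc (1 - a)^-1 = (1 - conjc a)^-1 by rewrite conjc_inv rmorphB rmorph1.
have uW : unitary_mx W.
  apply/unitary_mxP; rewrite /W cadjD cadjZ cadjM mulmxDl !mulmxDr DD.
  rewrite -!scalemxAl -!scalemxAr [cadj D *m (c *m b)]mulmxA Dc.
  rewrite -[cadj b *m cadj c *m D]mulmxA cD.
  rewrite -[cadj b *m cadj c *m (c *m b)]mulmxA [cadj c *m (c *m b)]mulmxA cc mul_scalar_mx.
  rewrite mulNmx mulmxN -scalemxAl -!scalemxAr.
  rewrite cK.
  set X := cadj b *m b.
  (* Everything except the identity is a multiple of [X]; the coefficient vanishes because [c] has
     squared norm [1 - |a|^2]. *)
  rewrite !scalerN !scalerA -!scaleNr -[X in 1%:M - X + _ + _]scale1r -!addrA -scaleNr -!scalerDl.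
  rewrite [X in X *: _](_ : _ = 0) ?scale0r ?addr0//.
  by rewrite /= ?conjc1 /GRing.scale/=; field; rewrite a1 a1'.
exists W => // U' hU'.
(* Factoring produces [U' *m W]; the order is exchanged so that left invariance in [U'] can remove
   [W]. *)
rewrite -/a -(det_1BMC _ (unitary_unit hU')) UE diagU.
rewrite [1%:M]scalar_mx_block opp_block_mx add_block_mx !add0r -raddfB/=.
have -> : block_mx (1 - a)%:M (- b) (- (U' *m c)) (1%:M - U' *m D) =
   block_mx (1 - a)%:M 0 (- (U' *m c)) (1%:M - U' *m W) *m
   block_mx 1%:M (- ((1 - a)^-1 *: b)) 0 1%:M.
  rewrite mulmx_block !mulmx1 !mulmx0 !addr0 mulmxN mul_scalar_mx scalerA divff// scale1r.
  congr block_mx; rewrite mulNmx mulmxN opprK /W mulmxDr -scalemxAr -scalemxAr mulmxA.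
  by rewrite [RHS]addrC opprD [in RHS]addrA subrK.
by rewrite det_mulmx det_lblock det_ublock !det1 !mulr1 det_scalar1.
Qed.

(** A complex analogue of a Householder reflection: a rank-one correction of the identity along
    [w = r - e], where [e] is the first unit row. It is unitary because the squared norm of [w] is
    [- (w0 + conjc w0)], [w0] being its first coordinate. *)
Lemma unitary_first_row n (r : 'rV[C]_(1 + n)) : r *m cadj r = 1%:M ->
  exists2 V : 'M[C]_(1 + n), unitary_mx V & row 0 V = r.
Proof.
move=> rr.
pose e : 'rV[C]_(1 + n) := delta_mx 0 0.
have [w wE] : exists w : 'rV[C]_(1 + n), w = r - e by exists (r - e).
pose w0 := w 0 0.
have re : r *m cadj e = (r 0 0)%:M.
  rewrite [LHS]mx11_scalar; congr (_%:M); rewrite mxE (bigD1 0)//= big1 => [|i i0].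
    by rewrite !mxE conjc_nat !eqxx mulr1 addr0.
  by rewrite !mxE conjc_nat (negbTE i0) andbF mulr0.
have er : e *m cadj r = (conjc (r 0 0))%:M.
  by rewrite -[e]cadjK -cadjM re cadj_scalar.
have ee : e *m cadj e = 1%:M.
  rewrite [LHS]mx11_scalar; congr (_%:M); rewrite mxE (bigD1 0)//= big1 => [|i i0].
    by rewrite !mxE conjc_nat !eqxx mulr1 addr0.
  by rewrite !mxE conjc_nat (negbTE i0) andbF mul0r.
have w0E : w0 = r 0 0 - 1 by rewrite /w0 wE !mxE !eqxx.
have ww : w *m cadj w = (- (w0 + conjc w0))%:M.
  have -> : cadj w = cadj r - cadj e by rewrite wE -[- e]scaleN1r cadjD cadjZ rmorphN1 scaleN1r.
  rewrite w0E wE mulmxBr !mulmxBl rr re er ee rmorphB rmorph1 -!raddfB/=; congr (_%:M); ring.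
(* If [w0] vanishes, so does the norm of [w], and [r] is already the first unit row. *)
have [w00|w00] := eqVneq w0 0.
  have w_0 : w = 0.
    have {}ww : w *m cadj w = 0 by rewrite ww w00 conjc0 addr0 oppr0 raddf0.
    have : cadj (cadj w) *m cadj w = 0 by rewrite cadjK.
    by move=> /cadj_self_eq0 h; rewrite -[w]cadjK h /cadj map_mx0 trmx0.
  exists 1%:M; first by apply/unitary_mxP; rewrite cadj_scalar conjc1 mulmx1.
  by rewrite row1; apply/esym/subr0_eq; rewrite -/e -wE.
have w00' : conjc w0 != 0 by rewrite conjc_eq0.
pose al := (conjc w0)^-1.
exists (1%:M + al *: (cadj w *m w)).
  apply/unitary_mxP; rewrite cadjD cadjZ cadjM cadjK cadj_scalar conjc1 mulmxDl mul1mx !mulmxDr mulmx1.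
  rewrite -scalemxAl -scalemxAr.
  rewrite -[cadj w *m w *m (_ *m w)]mulmxA [w *m (_ *m w)]mulmxA ww mul_scalar_mx -scalemxAr.
  rewrite !scalerA -!addrA -!scalerDl [X in X *: _](_ : _ = 0) ?scale0r ?addr0//.
  by rewrite /al conjc_inv conjcK; field; rewrite w00 w00'.
rewrite linearD/= row1 linearZ/= row_mul.
have -> : row 0 (cadj w) = (conjc w0)%:M.
  by rewrite [LHS]mx11_scalar; congr (_%:M); rewrite !mxE.
by rewrite mul_scalar_mx scalerA /al mulVf// scale1r wE addrC subrK.
Qed.
End UnitaryAlgebra.

(** * Measurability of complex and matrix-valued functions *)

Section ComplexMeasurable.
Variable R : realType.
Local Notation C := R[i].
Context (d : measure_display) (T : measurableType d).
Implicit Types f g : T -> C.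

(** Measurability is tested on the two real coordinates, matching the generators in [entry_gen]. *)
Definition cmeas f := measurable_fun setT (fun x => complex.Re (f x)) /\
  measurable_fun setT (fun x => complex.Im (f x)).

Lemma cmeas_cst (c : C) : cmeas (fun=> c).
Proof. by split; exact: measurable_cst. Qed.

Lemma cmeasD f g : cmeas f -> cmeas g -> cmeas (fun x => f x + g x).
Proof.
move=> [f1 f2] [g1 g2]; split.
  rewrite (_ : (fun x => _) = fun x => complex.Re (f x) + complex.Re (g x)); last first.
    by apply/funext => x; rewrite raddfD.
  exact: measurable_funD.
rewrite (_ : (fun x => _) = fun x => complex.Im (f x) + complex.Im (g x)); last first.
  by apply/funext => x; rewrite raddfD.
exact: measurable_funD.
Qed.

Lemma cmeasM f g : cmeas f -> cmeas g -> cmeas (fun x => f x * g x).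
Proof.
move=> [f1 f2] [g1 g2]; split.
  rewrite (_ : (fun x => _) = fun x => complex.Re (f x) * complex.Re (g x)
      - complex.Im (f x) * complex.Im (g x)); last first.
    by apply/funext => x; case: (f x) (g x) => [? ?] [? ?].
  by apply: measurable_funB; exact: measurable_funM.
rewrite (_ : (fun x => _) = fun x => complex.Re (f x) * complex.Im (g x)
    + complex.Im (f x) * complex.Re (g x)); last first.
  by apply/funext => x; case: (f x) (g x) => [? ?] [? ?].
by apply: measurable_funD; exact: measurable_funM.
Qed.

Lemma cmeasN f : cmeas f -> cmeas (fun x => - f x).
Proof.
move=> mf; rewrite (_ : (fun x => _) = fun x => (-1) * f x).
  by apply: cmeasM => //; exact: cmeas_cst.
by apply/funext => x; rewrite mulN1r.
Qed.

Lemma cmeas_sum (I : Type) (r : seq I) (P : pred I) (F : I -> T -> C) :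
  (forall i, cmeas (F i)) -> cmeas (fun x => \sum_(i <- r | P i) F i x).
Proof.
move=> mF; elim: r => [|i r IH].
  by under eq_fun do rewrite big_nil; exact: cmeas_cst.
under eq_fun do rewrite big_cons.
by case: (P i) => //; exact: cmeasD.
Qed.

Lemma cmeas_prod (I : Type) (r : seq I) (P : pred I) (F : I -> T -> C) :
  (forall i, cmeas (F i)) -> cmeas (fun x => \prod_(i <- r | P i) F i x).
Proof.
move=> mF; elim: r => [|i r IH].
  by under eq_fun do rewrite big_nil; exact: cmeas_cst.
under eq_fun do rewrite big_cons.
by case: (P i) => //; exact: cmeasM.
Qed.

Lemma cmeas_det n (A : T -> 'M[C]_n) : (forall i j, cmeas (fun x => A x i j)) ->
  cmeas (fun x => \det (A x)).
Proof.
move=> mA; apply: cmeas_sum => s; apply: cmeasM; first exact: cmeas_cst.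
by apply: cmeas_prod => i; exact: mA.
Qed.

Lemma cmeas_mulmx m n p (A : T -> 'M[C]_(m, n)) (B : T -> 'M[C]_(n, p)) :
  (forall i j, cmeas (fun x => A x i j)) -> (forall i j, cmeas (fun x => B x i j)) ->
  forall i j, cmeas (fun x => (A x *m B x) i j).
Proof.
move=> mA mB i j; under eq_fun do rewrite mxE.
by apply: cmeas_sum => k; exact: cmeasM.
Qed.

Lemma cmeas_det1B n (A : T -> 'M[C]_n) : (forall i j, cmeas (fun x => A x i j)) ->
  cmeas (fun x => \det (1%:M - A x)).
Proof.
move=> mA; apply: cmeas_det => i j.
under eq_fun do rewrite !mxE.
by apply: cmeasD; [exact: cmeas_cst|exact: cmeasN].
Qed.

Lemma cmeas_block n (A : T -> 'M[C]_n) : (forall i j, cmeas (fun x => A x i j)) ->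
  forall i j, cmeas (fun x => (block_mx (1%:M : 'M[C]_1) 0 0 (A x)) i j).
Proof.
move=> mA i j; rewrite /block_mx; under eq_fun do rewrite mxE.
by case: (fintype.split i) => k; under eq_fun do rewrite mxE;
  case: (fintype.split j) => l //; exact: cmeas_cst.
Qed.

Definition absC (z : C) : R := Num.sqrt ((complex.Re z) ^+ 2 + (complex.Im z) ^+ 2).

Lemma measurable_absC f : cmeas f -> measurable_fun setT (fun x => absC (f x)).
Proof.
move=> [f1 f2].
have ms : measurable_fun setT (@Num.sqrt R).
  by apply: continuous_measurable_fun; exact: sqrt_continuous.
apply: (measurableT_comp ms).
by apply: measurable_funD; exact: measurable_funX.
Qed.

Lemma absCM (z w : C) : absC (z * w) = absC z * absC w.
Proof.
rewrite /absC -sqrtrM ?addr_ge0 ?sqr_ge0//; congr Num.sqrt.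
by case: z w => [a b] [c e] /=; ring.
Qed.

Lemma absC_ge0 (z : C) : 0 <= absC z.
Proof. exact: sqrtr_ge0. Qed.

Lemma measurable_mx N (F : T -> MatSpace R N) :
  (forall i j, cmeas (fun x => (F x : 'M[C]_N) i j)) -> measurable_fun setT F.
Proof.
move=> mF; apply: (@measurability _ _ T (MatSpace R N) setT F (@entry_gen R N)) => //.
move=> _ [A [i [j [B [mB [->|->]]]]] <-].
  by have [mR _] := mF i j; exact: (mR measurableT B mB).
by have [_ mI] := mF i j; exact: (mI measurableT B mB).
Qed.
End ComplexMeasurable.

Lemma cmeas_comp (R : realType) (d d' : measure_display) (T : measurableType d) (T' : measurableType d')
    (f : T -> R[i]) (g : T' -> T) : cmeas f -> measurable_fun setT g -> cmeas (fun x => f (g x)).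
Proof.
by move=> [f1 f2] mg; split; [exact: (measurableT_comp f1)|exact: (measurableT_comp f2)].
Qed.

Lemma cmeas_entry (R : realType) N (i j : 'I_N) :
  cmeas (fun U : MatSpace R N => (U : 'M[R[i]]_N) i j).
Proof.
split => _ B mB; rewrite setTI; apply: sub_sigma_algebra; exists i, j, B; split => //.
  by left.
by right.
Qed.

(** * Integration against Haar measure *)

Section Haar.
Variable R : realType.
Local Notation C := R[i].

Section OneHaar.
Variables (N : nat) (mu : probability (MatSpace R N) R).
Hypothesis hmu : is_Haar_UN mu.
Local Notation D := (@unitary_mx R N : set (MatSpace R N)).

Lemma measurable_unitary : measurable D.
Proof. by case: hmu. Qed.

Lemma haar_unitary : mu D = 1%E.
Proof. by case: hmu => _ []. Qed.

Lemma measurable_mul (V : 'M[C]_N) :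
  measurable_fun setT (fun U : MatSpace R N => V *m (U : 'M[C]_N) : MatSpace R N).
Proof.
apply: measurable_mx => i j; apply: cmeas_mulmx => k l; first exact: cmeas_cst.
exact: cmeas_entry.
Qed.

Lemma haar_invariant_ge0 (V : 'M[C]_N) (f : MatSpace R N -> \bar R) : unitary_mx V ->
  measurable_fun setT f -> (forall U, 0 <= f U)%E ->
  (\int[mu]_U f (V *m (U : 'M[C]_N)) = \int[mu]_U f U)%E.
Proof.
move=> hV mf f0.
have := @ge0_integral_pushforward _ _ _ _ R _ (measurable_mul V) mu setT f measurableT mf.
move=> /(_ (fun y _ => f0 y)); rewrite preimage_setT => <-.
apply: eq_measure_integral; first exact: measurable_mul.
move=> mV A mA _; by case: hmu => _ [_ /(_ V hV A mA)].
Qed.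

Lemma haar_invariant_Rintegral (V : 'M[C]_N) (f : MatSpace R N -> R) (M : R) : unitary_mx V ->
  measurable_fun setT f -> (forall U, D U -> `|f U| <= M) ->
  \int[mu]_(U in D) f (V *m (U : 'M[C]_N)) = \int[mu]_(U in D) f U.
Proof.
move=> hV mf fM; rewrite /Rintegral; congr fine.
(* Multiplication by [V] preserves the unitary group in both directions, so the restricted integral
   is invariant too. *)
have DE : (fun U : MatSpace R N => V *m (U : 'M[C]_N) : MatSpace R N) @^-1` D = D.
  apply/seteqP; split => U /= hU; last exact: unitaryM.
  have -> : U = cadj V *m (V *m (U : 'M[C]_N)) :> 'M[C]_N.
    by rewrite mulmxA (_ : cadj V *m V = 1%:M) ?mul1mx.
  by apply: unitaryM => //; exact: unitary_adj.
have mf' : measurable_fun setT (EFin \o f) by exact/measurable_EFinP.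
have := @integral_pushforward _ _ _ _ R _ (measurable_mul V) mu D _ mf'.
rewrite DE => <-.
- apply: eq_measure_integral; first exact: measurable_mul.
  move=> mV A mA _; by case: hmu => _ [_ /(_ V hV A mA)].
- apply: measurable_bounded_integrable.
  + exact: measurable_unitary.
  + by rewrite -ge0_fin_numE// fin_num_measure//; exact: measurable_unitary.
  + apply: measurable_funTS; apply: (measurableT_comp mf); exact: measurable_mul.
  + exists M; split; rewrite ?num_real// => y My U DU.
    by apply: le_trans (ltW My); apply: fM; exact: unitaryM.
- exact: measurable_unitary.
Qed.

(** The measure lives on the whole matrix space, while the algebraic identities hold on the group
    only; discarding the null complement makes them available under the integral. *)
Lemma haar_integral_unitary (f : MatSpace R N -> \bar R) : measurable_fun setT f -> (forall U, 0 <= f U)%E ->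
  (\int[mu]_U f U = \int[mu]_(U in D) f U)%E.
Proof.
move=> mf f0.
have mD := measurable_unitary.
rewrite (@ge0_negligible_integral _ _ _ mu setT (~` D))//.
- by rewrite setDE setTI setCK.
- exact: measurableC.
- by have := probability_setC mu mD; rewrite haar_unitary subee.
Qed.
End OneHaar.

(** Inserting [block_mx 1 0 0 U'] on the left of [U] leaves the [mu1]-integral unchanged for each
    unitary [U']. After averaging over [U'] and exchanging the integrals by Tonelli, [unitary_schur]
    applies for fixed [U]. Its matrix [W] depends on [U] alone, so invariance of [mu0] removes
    it. *)
Lemma absdet_rec n (mu1 : probability (MatSpace R (1 + n)) R) (mu0 : probability (MatSpace R n) R)
    (f : R -> R) : is_Haar_UN mu1 -> is_Haar_UN mu0 ->
  measurable_fun setT f -> (forall x, 0 <= f x) ->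
  (\int[mu1]_U (f (absC (\det (1%:M - (U : 'M[C]_(1 + n))))))%:E =
   \int[mu1]_U \int[mu0]_U' (f (absC (1 - (U : 'M[C]_(1 + n)) 0%R 0%R) *
      absC (\det (1%:M - (U' : 'M[C]_n)))))%:E)%E.
Proof.
move=> h1 h0 mf f0.
pose F (p : MatSpace R n * MatSpace R (1 + n)) :=
  (f (absC (\det (1%:M - block_mx (1%:M : 'M[C]_1) 0 0 (p.1 : 'M[C]_n) *m (p.2 : 'M[C]_(1 + n))))))%:E.
have mfst : measurable_fun setT (fst : MatSpace R n * MatSpace R (1 + n) -> MatSpace R n).
  exact: measurable_fst.
have msnd : measurable_fun setT (snd : MatSpace R n * MatSpace R (1 + n) -> MatSpace R (1 + n)).
  exact: measurable_snd.
have mentry1 i j : cmeas (fun p : MatSpace R n * MatSpace R (1 + n) => (p.1 : 'M[C]_n) i j).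
  refine (@cmeas_comp R _ _ _ _ (fun U : MatSpace R n => (U : 'M[C]_n) i j) fst _ _).
    exact: cmeas_entry.
  exact: mfst.
have mentry2 i j : cmeas (fun p : MatSpace R n * MatSpace R (1 + n) => (p.2 : 'M[C]_(1 + n)) i j).
  refine (@cmeas_comp R _ _ _ _ (fun U : MatSpace R (1 + n) => (U : 'M[C]_(1 + n)) i j) snd _ _).
    exact: cmeas_entry.
  exact: msnd.
have mF : measurable_fun setT F.
  apply/measurable_EFinP; apply: (measurableT_comp mf); apply: measurable_absC.
  by apply: cmeas_det1B; apply: cmeas_mulmx => //; exact: cmeas_block.
have F0 p : (0 <= F p)%E by rewrite lee_fin.
pose g (U : MatSpace R (1 + n)) := (f (absC (\det (1%:M - (U : 'M[C]_(1 + n))))))%:E.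
have mg : measurable_fun setT g.
  apply/measurable_EFinP; apply: (measurableT_comp mf); apply: measurable_absC.
  by apply: cmeas_det1B => i j; exact: cmeas_entry.
have g0 U : (0 <= g U)%E by rewrite lee_fin.
have step1 : (\int[mu0]_U' \int[mu1]_U F (U', U) = \int[mu1]_U g U)%E.
  rewrite (haar_integral_unitary h0); last 2 first.
    exact: measurable_fun_fubini_tonelli_F.
    by move=> U; apply: integral_ge0.
  rewrite (eq_integral (fun=> \int[mu1]_U g U)%E); last first.
    move=> U'; rewrite inE => hU'.
    exact: (haar_invariant_ge0 h1 (unitary_block hU') mg g0).
  rewrite integral_cst; last exact: (measurable_unitary h0).
  by rewrite -[RHS]mule1; congr (_ * _)%E; exact: (haar_unitary h0).
transitivity (\int[mu1]_U \int[mu0]_U' F (U', U))%E.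
  by rewrite -[LHS]step1; exact: fubini_tonelli.
pose H (p : MatSpace R n * MatSpace R (1 + n)) :=
  (f (absC (1 - (p.2 : 'M[C]_(1 + n)) 0%R 0%R) * absC (\det (1%:M - (p.1 : 'M[C]_n)))))%:E.
have mH : measurable_fun setT H.
  apply/measurable_EFinP; apply: (measurableT_comp mf); apply: measurable_funM.
    apply: measurable_absC; apply: cmeasD; first exact: cmeas_cst.
    exact: cmeasN.
  by apply: measurable_absC; exact: cmeas_det1B.
have H0 p : (0 <= H p)%E by rewrite lee_fin.
rewrite (haar_integral_unitary h1); last 2 first.
  exact: measurable_fun_fubini_tonelli_G.
  by move=> U; apply: integral_ge0.
rewrite [RHS](haar_integral_unitary h1); last 2 first.
  exact: (measurable_fun_fubini_tonelli_G H mH H0).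
  by move=> U; apply: integral_ge0 => U' _; rewrite lee_fin.
apply: eq_integral => U; rewrite inE => hU.
have [W hW HW] := unitary_schur hU.
pose G (U' : MatSpace R n) := (f (absC (1 - (U : 'M[C]_(1 + n)) 0%R 0%R) *
  absC (\det (1%:M - (U' : 'M[C]_n)))))%:E.
have mG : measurable_fun setT G.
  apply/measurable_EFinP; apply: (measurableT_comp mf).
  apply: measurable_funM; first exact: measurable_cst.
  by apply: measurable_absC; apply: cmeas_det1B => i j; exact: cmeas_entry.
have G0 U' : (0 <= G U')%E by rewrite lee_fin.
transitivity (\int[mu0]_U' G (W *m (U' : 'M[C]_n)))%E; last exact: (haar_invariant_ge0 h0 hW mG G0).
rewrite [RHS](haar_integral_unitary h0); last 2 first.
  exact: (measurableT_comp mG (measurable_mul W)).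
  by move=> U'; exact: G0.
rewrite [LHS](haar_integral_unitary h0); last 2 first.
  apply/measurable_EFinP; apply: (measurableT_comp mf); apply: measurable_absC.
  apply: cmeas_det1B; apply: cmeas_mulmx => [|i j]; last exact: cmeas_cst.
  by apply: cmeas_block => i j; exact: cmeas_entry.
  by move=> U'; exact: F0.
apply: eq_integral => U'; rewrite inE => hU'.
by rewrite /F /G/= HW// absCM.
Qed.
End Haar.

(** * Moments of the corner entry *)

Section Moments.
Variable R : realType.
Local Notation C := R[i].

Definition sqC (z : C) : R := complex.Re z ^+ 2 + complex.Im z ^+ 2.

Lemma sqC_ge0 z : 0 <= sqC z.
Proof. by rewrite addr_ge0 ?sqr_ge0. Qed.

Lemma sqCM z w : sqC (z * w) = sqC z * sqC w.
Proof. by case: z w => [a b] [c e]; rewrite /sqC /=; ring. Qed.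

Lemma sqCE (z : C) : sqC z = complex.Re (conjc z * z).
Proof. by case: z => a b; rewrite /sqC /=; ring. Qed.

Lemma unitary_col_norm N (U : 'M[C]_N) j : unitary_mx U -> \sum_i sqC (U i j) = 1.
Proof.
move=> /unitary_mxP hU.
have := congr1 (fun M : 'M[C]_N => complex.Re (M j j)) hU.
rewrite !mxE eqxx raddf_sum/= => <-.
by apply: eq_bigr => i _; rewrite sqCE !mxE.
Qed.

Lemma unitary_entry_le1 N (U : 'M[C]_N) i j : unitary_mx U -> sqC (U i j) <= 1.
Proof.
move=> /(unitary_col_norm j) <-; rewrite (bigD1 i)//= lerDl sumr_ge0// => k _.
exact: sqC_ge0.
Qed.

Section IntegralSum.
Context (d : measure_display) (T : measurableType d).
Variables (P : probability T R) (D : set T).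
Hypotheses (mD : measurable D).

Lemma Rintegral_sum (I : Type) (r : seq I) (F : I -> T -> R) :
  (forall i, P.-integrable D (EFin \o F i)) ->
  P.-integrable D (EFin \o (fun x => \sum_(i <- r) F i x)) /\
  \int[P]_(x in D) (\sum_(i <- r) F i x) = \sum_(i <- r) \int[P]_(x in D) F i x.
Proof.
move=> iF; elim: r => [|i r [IH1 IH2]].
  have -> : (fun x => \sum_(i <- [::]) F i x) = fun=> 0 by apply/funext => x; rewrite big_nil.
  split; first exact: integrable_const.
  by rewrite big_nil Rintegral_cst// mul0r.
have -> : (fun x => \sum_(j <- i :: r) F j x) = fun x => F i x + \sum_(j <- r) F j x.
  by apply/funext => x; rewrite big_cons.
split; first exact: integrable_addf.
by rewrite RintegralD// IH2 big_cons.
Qed.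
End IntegralSum.

Variables (n : nat) (mu : probability (MatSpace R (1 + n)) R).
Hypothesis hmu : is_Haar_UN mu.
Local Notation D := (@unitary_mx R (1 + n) : set (MatSpace R (1 + n))).
Local Notation E f := (\int[mu]_(U in D) f U).
Let mD : measurable D := measurable_unitary hmu.
Let muD : mu D = 1%E := haar_unitary hmu.
Let Nr : R := (1 + n)%:R.
Let Nr0 : 0 < Nr. Proof. by rewrite ltr0n. Qed.

Let ent (i : 'I_(1 + n)) (U : MatSpace R (1 + n)) : C := (U : 'M[C]_(1 + n)) i 0.

Lemma measurable_sqC_cmeas (d : measure_display) (T : measurableType d) (f : T -> C) :
  cmeas f -> measurable_fun setT (fun x => sqC (f x)).
Proof. by move=> [f1 f2]; apply: measurable_funD; exact: measurable_funX. Qed.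

Let msq i : measurable_fun setT (fun U => sqC (ent i U)).
Proof. by apply: measurable_sqC_cmeas; exact: cmeas_entry. Qed.

Let mRe : measurable_fun setT (fun U => complex.Re (ent 0 U)).
Proof. by have [] := cmeas_entry R (0 : 'I_(1 + n)) 0. Qed.

Let sq_le1 i U : D U -> sqC (ent i U) <= 1.
Proof. exact: unitary_entry_le1. Qed.

Let isqM i j : mu.-integrable D (EFin \o (fun U => sqC (ent i U) * sqC (ent j U))).
Proof.
apply: (@integrable_bounded _ _ _ _ _ mD _ 1).
  by apply: measurable_funTS; apply: measurable_funM; exact: msq.
move=> U DU; rewrite normrM !ger0_norm ?sqC_ge0// mulr_ile1 ?sqC_ge0//; exact: sq_le1.
Qed.

Let isq i : mu.-integrable D (EFin \o (fun U => sqC (ent i U))).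
Proof.
apply: (@integrable_bounded _ _ _ _ _ mD _ 1).
  by apply: measurable_funTS; exact: msq.
by move=> U DU; rewrite ger0_norm ?sqC_ge0//; exact: sq_le1.
Qed.

(** Invariance under the scalar matrix [-1]. *)
Lemma haar_mean0 : E (fun U => complex.Re (ent 0 U)) = 0.
Proof.
have hV : unitary_mx ((-1)%:M : 'M[C]_(1 + n)).
  by apply: unitary_scalar; rewrite rmorphN1 mulrNN mulr1.
have H := @haar_invariant_Rintegral R _ mu hmu _ (fun U => complex.Re (ent 0 U)) 1 hV mRe.
have {}H : E (fun U => complex.Re (ent 0 ((-1)%:M *m (U : 'M[C]_(1 + n))))) =
    E (fun U => complex.Re (ent 0 U)).
  apply: H => U DU; rewrite -(@expr_le1 _ 2)// real_normK ?num_real//.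
  by apply: le_trans (sq_le1 0 DU); rewrite lerDl sqr_ge0.
have H2 : E (fun U => complex.Re (ent 0 ((-1)%:M *m (U : 'M[C]_(1 + n))))) =
    - E (fun U => complex.Re (ent 0 U)).
  rewrite -[RHS]mulN1r -RintegralZl//.
    by apply: eq_Rintegral => U _; rewrite /ent mul_scalar_mx mxE mulN1r raddfN mulN1r.
  apply: (@integrable_bounded _ _ _ _ _ mD _ 1).
    by apply: measurable_funTS; exact: mRe.
  move=> U DU; rewrite -(@expr_le1 _ 2)// real_normK ?num_real//.
  by apply: le_trans (sq_le1 0 DU); rewrite lerDl sqr_ge0.
by move: H; rewrite H2; lra.
Qed.

(** Multiplication by the imaginary unit exchanges the two squares. *)
Lemma haar_Re2_Im2 : E (fun U => complex.Re (ent 0 U) ^+ 2) = E (fun U => complex.Im (ent 0 U) ^+ 2).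
Proof.
have hV : unitary_mx (('i%C)%:M : 'M[C]_(1 + n)).
  by apply: unitary_scalar; apply/eqP; rewrite eq_complex/=; apply/andP; split; apply/eqP; ring.
have := @haar_invariant_Rintegral R _ mu hmu _ (fun U => complex.Re (ent 0 U) ^+ 2) 1 hV.
move=> /(_ (measurable_funX 2 mRe)) <-.
  apply: eq_Rintegral => U _; rewrite /ent mul_scalar_mx mxE mulrC.
  by case: ((U : 'M[C]_(1 + n)) 0 0) => x y /=; ring.
move=> U DU; rewrite ger0_norm ?sqr_ge0//.
by apply: le_trans (sq_le1 0 DU); rewrite lerDl sqr_ge0.
Qed.

(** Completing [r] to a unitary [V] makes this left invariance for the corner entry of [V *m U]. All
    further moments are obtained by a choice of the unit row [r]. *)
Lemma haar_row p (r : 'rV[C]_(1 + n)) : r *m cadj r = 1%:M ->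
  E (fun U => sqC ((r *m (U : 'M[C]_(1 + n))) 0 0) ^+ p) = E (fun U => sqC (ent 0 U) ^+ p).
Proof.
move=> /unitary_first_row[V hV <-].
rewrite -(@haar_invariant_Rintegral R _ mu hmu V (fun U => sqC (ent 0 U) ^+ p) 1 hV).
- by apply: eq_Rintegral => U _; rewrite -row_mul mxE.
- by apply: measurable_funX; exact: msq.
- by move=> U DU; rewrite normrX exprn_ile1// ger0_norm ?sqC_ge0//; exact: sq_le1.
Qed.

Let dl (i : 'I_(1 + n)) : 'rV[C]_(1 + n) := delta_mx 0 i.

Let dl_adj i j : dl i *m cadj (dl j) = (i == j)%:R%:M.
Proof.
rewrite [LHS]mx11_scalar; congr (_%:M); rewrite mxE (bigD1 i)//= big1 => [|k ki].
  by rewrite !mxE conjc_nat !eqxx mul1r addr0.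
by rewrite !mxE (negbTE ki) andbF mul0r.
Qed.

Let dl_adj1 i : dl i *m cadj (dl i) = 1%:M.
Proof. by rewrite dl_adj eqxx. Qed.

Let dl_adj0 i j : i != j -> dl i *m cadj (dl j) = 0.
Proof. by move=> ij; rewrite dl_adj (negbTE ij) raddf0. Qed.

Let dl_mul i (U : 'M[C]_(1 + n)) : (dl i *m U) 0 0 = U i 0.
Proof. by rewrite -rowE mxE. Qed.

Lemma haar_entry p i : E (fun U => sqC (ent i U) ^+ p) = E (fun U => sqC (ent 0 U) ^+ p).
Proof.
rewrite -(@haar_row p (dl i)); last by rewrite dl_adj eqxx.
by apply: eq_Rintegral => U _; rewrite dl_mul.
Qed.

(** The entries of the first column have equal second moments, and their squared moduli add up to
    1. *)
Lemma haar_sq : E (fun U => sqC (ent 0 U)) = Nr^-1.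
Proof.
have [_] := @Rintegral_sum _ _ mu _ mD _ (index_enum 'I_(1 + n)) _ isq.
rewrite (@eq_Rintegral _ _ _ _ _ (fun=> 1)); last first.
  by move=> U; rewrite inE => DU; exact: unitary_col_norm.
rewrite (Rintegral_cst1 mD muD).
have h i : E (fun U => sqC (ent i U)) = E (fun U => sqC (ent 0 U)) by exact: (haar_entry 1 i).
rewrite (eq_bigr _ (fun i _ => h i)).
rewrite sumr_const card_ord -mulr_natl => H.
by apply: (mulfI (lt0r_neq0 Nr0)); rewrite divff ?gt_eqF.
Qed.

Let half : C := (Complex (Num.sqrt 2^-1) 0).

Let half2 : sqC half = 2^-1.
Proof. by rewrite /sqC /half /= expr0n addr0 sqr_sqrtr. Qed.

Let half2' : conjc half * half = 2^-1.
Proof.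
have h : (Num.sqrt 2^-1) * (Num.sqrt 2^-1) = 2^-1 :> R by rewrite -expr2 sqr_sqrtr.
apply: (@mulfI _ 2); first by rewrite pnatr_eq0.
rewrite divff ?pnatr_eq0//; apply/eqP; rewrite eq_complex/= oppr0 !mulr0 !mul0r !subr0 !addr0 h.
by apply/andP; split; apply/eqP; field.
Qed.

Let haar_pair_row i j (zt : C) : i != j -> conjc zt * zt = 1 ->
  E (fun U => 4^-1 * sqC (ent i U + zt * ent j U) ^+ 2) = E (fun U => sqC (ent 0 U) ^+ 2).
Proof.
move=> ij z1; rewrite -(@haar_row 2 (half *: (dl i + zt *: dl j))).
  apply: eq_Rintegral => U _.
  rewrite -scalemxAl mulmxDl -scalemxAl.
  have -> : (half *: (dl i *m (U : 'M[C]_(1 + n)) + zt *: (dl j *m (U : 'M[C]_(1 + n))))) 0 0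
      = half * (ent i U + zt * ent j U).
    rewrite mxE; congr (_ * _); rewrite mxE dl_mul; congr (_ + _).
    by rewrite mxE dl_mul.
  by rewrite sqCM half2 exprMn; congr (_ * _); field.
rewrite cadjZ cadjD cadjZ -scalemxAl -scalemxAr mulmxDl !mulmxDr -!scalemxAl -!scalemxAr.
have ji : j != i by rewrite eq_sym.
rewrite !dl_adj1 (dl_adj0 ij) (dl_adj0 ji) !scaler0 addr0 add0r.
rewrite !scalerA [zt * _]mulrC z1 scale1r [half * _]mulrC half2' -mulr2n -[1%:M *+ 2]scaler_nat scalerA.
by rewrite mulVf ?scale1r// pnatr_eq0.
Qed.

(** Polarisation: the mean of [|x + zt y|^4] over the fourth roots of unity [zt] is
    [|x|^4 + |y|^4 + 4 |x|^2 |y|^2]. The unit rows proportional to [dl i + zt *: dl j] give each of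
    the four terms the expectation [q], the fourth moment of the corner, whence
    [4 q = 2 q + 4 E(|x|^2 |y|^2)]. *)
Lemma haar_pair i j :
  E (fun U => sqC (ent i U) * sqC (ent j U)) = (1 + (i == j)%:R) * (E (fun U => sqC (ent 0 U) ^+ 2) / 2).
Proof.
have [<-|ij] := eqVneq i j.
  rewrite -(haar_entry 2 i) mulrC -mulrA -[1 + _]/(2%:R) mulVf ?mulr1 ?pnatr_eq0//.
rewrite addr0 mul1r.
pose q := E (fun U => sqC (ent 0 U) ^+ 2).
have iz (zt : C) : conjc zt * zt = 1 ->
   mu.-integrable D (EFin \o (fun U => 4^-1 * sqC (ent i U + zt * ent j U) ^+ 2)).
  move=> z1; apply: integrableZ => //.
  apply: (@integrable_bounded _ _ _ _ _ mD _ 16).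
    apply: measurable_funTS; apply: measurable_funX; apply: measurable_sqC_cmeas.
    apply: cmeasD; first exact: cmeas_entry.
    by apply: cmeasM; [exact: cmeas_cst|exact: cmeas_entry].
  move=> U DU; rewrite normrX (_ : 16 = 4 ^+ 2); last by ring.
  rewrite lerXn2r ?nnegrE// ger0_norm ?sqC_ge0//.
  have z2 : sqC zt = 1 by rewrite sqCE z1.
  have h1 := sq_le1 i DU.
  have : sqC (zt * ent j U) <= 1 by rewrite sqCM z2 mul1r; exact: sq_le1.
  move: h1; case: (ent i U) (zt * ent j U) => [a b] [c e]; rewrite /sqC/=.
  have := sqr_ge0 (a - c); have := sqr_ge0 (b - e); nra.
have c1 : conjc (1 : C) * 1 = 1 by rewrite rmorph1 mulr1.
have c2 : conjc (-1 : C) * -1 = 1 by rewrite rmorphN1 mulrNN mulr1.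
have c3 : conjc ('i%C : C) * 'i%C = 1.
  by apply/eqP; rewrite eq_complex/=; apply/andP; split; apply/eqP; ring.
have c4 : conjc (- 'i%C : C) * - 'i%C = 1 by rewrite rmorphN mulrNN.
have S : E (fun U => sqC (ent i U) * sqC (ent i U) + sqC (ent j U) * sqC (ent j U) +
    4 * (sqC (ent i U) * sqC (ent j U))) = 4 * q.
  have <- : E (fun U => 4^-1 * sqC (ent i U + 1 * ent j U) ^+ 2
      + 4^-1 * sqC (ent i U + -1 * ent j U) ^+ 2
      + 4^-1 * sqC (ent i U + 'i%C * ent j U) ^+ 2
      + 4^-1 * sqC (ent i U + - 'i%C * ent j U) ^+ 2) = 4 * q.
    have i1 := iz _ c1; have i2 := iz _ c2; have i3 := iz _ c3; have i4 := iz _ c4.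
    have i12 := integrable_addf mD i1 i2; have i123 := integrable_addf mD i12 i3.
    rewrite RintegralD// RintegralD// RintegralD// !haar_pair_row// -/q.
    by ring.
  apply: eq_Rintegral => U _.
  case: (ent i U) (ent j U) => [a b] [c e]; rewrite /sqC/=.
  by field.
move: S; rewrite RintegralD//; last 2 first.
  by apply: (integrable_addf mD); exact: isqM.
  exact: integrableZ.
rewrite RintegralD// RintegralZl//.
have qE k : E (fun U => sqC (ent k U) * sqC (ent k U)) = q.
  transitivity (E (fun U => sqC (ent k U) ^+ 2)); last exact: haar_entry.
  by apply: eq_Rintegral => U _; rewrite expr2.
rewrite !qE => S; lra.
Qed.

(** Squaring the norm of the first column and using [haar_pair] gives [(N^2 + N) q / 2 = 1] for the
    fourth moment [q]. *)
Lemma haar_sq2 : E (fun U => sqC (ent 0 U) ^+ 2) <= 2 / Nr ^+ 2.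
Proof.
set q := E _.
have q0 : 0 <= q by apply: Rintegral_ge0 => U _; rewrite sqr_ge0.
have [_] := @Rintegral_sum _ _ mu _ mD _ (index_enum _)
  (fun (p : 'I_(1 + n) * 'I_(1 + n)) U => sqC (ent p.1 U) * sqC (ent p.2 U)) (fun p => isqM p.1 p.2).
rewrite (@eq_Rintegral _ _ _ _ _ (fun=> 1)); last first.
  move=> U; rewrite inE => DU.
  rewrite -(pair_bigA _ (fun i j => sqC (ent i U) * sqC (ent j U)))/=.
  under eq_bigr do rewrite -mulr_sumr unitary_col_norm// mulr1.
  exact: unitary_col_norm.
rewrite (Rintegral_cst1 mD muD).
under eq_bigr do rewrite haar_pair -/q.
rewrite -mulr_suml -(pair_bigA _ (fun i j => 1 + (i == j)%:R))/=.
have -> : \sum_(i < 1 + n) \sum_(j < 1 + n) (1 + (i == j)%:R) = Nr ^+ 2 + Nr :> R.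
  rewrite (eq_bigr (fun=> Nr + 1)); last first.
    move=> i _; rewrite big_split/= sumr_const card_ord (bigD1 i)//= eqxx big1 ?addr0//.
    by move=> j; rewrite eq_sym => /negbTE ->.
  by rewrite sumr_const card_ord -mulr_natl -/Nr; ring.
move=> H; rewrite ler_pdivlMr ?exprn_gt0//.
have : 0 <= Nr * q by rewrite mulr_ge0// ltW.
lra.
Qed.

(** An atom of the corner entry at 1 would be copied by rotations to infinitely many points with the
    same mass. This makes the event [\det (1 - U) = 0] null and settles the junk value of [ln] at
    0. *)
Lemma haar_ne1 : E (fun U => (ent 0 U == 1)%:R) = 0.
Proof.
(* The rational parametrisation of the unit circle, for which injectivity is plain algebra. *)
pose c (t : nat) : C := Complex ((1 - t%:R ^+ 2) / (1 + t%:R ^+ 2)) (2 * t%:R / (1 + t%:R ^+ 2)).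
have t0 (t : nat) : 1 + t%:R ^+ 2 != 0 :> R by rewrite gt_eqF// ltr_pwDl// sqr_ge0.
have c1 t : conjc (c t) * c t = 1.
  apply/eqP; rewrite eq_complex/=; apply/andP; split; apply/eqP; last by ring.
  by field.
have c_inj : injective c.
  move=> s t [] /(congr1 (fun x => x + 1)).
  rewrite (_ : _ + 1 = 2 / (1 + s%:R ^+ 2)); last by field.
  rewrite (_ : _ + 1 = 2 / (1 + t%:R ^+ 2)); last by field.
  move=> /(mulfI (_ : 2 != 0 :> R)); rewrite pnatr_eq0 => /(_ isT)/invr_inj/addrI/eqP.
  by rewrite eqrXn2// eqr_nat => /eqP ? _.
have mI t : measurable_fun setT (fun U => (ent 0 U == c t)%:R : R).
  rewrite (_ : (fun U => _) = \1_((fun U => complex.Re (ent 0 U)) @^-1` [set complex.Re (c t)] `&`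
     (fun U => complex.Im (ent 0 U)) @^-1` [set complex.Im (c t)])); last first.
    apply/funext => U; rewrite indicE; congr ((nat_of_bool _)%:R); rewrite eq_complex.
    apply/idP/idP; first by move=> /andP[/eqP h1 /eqP h2]; rewrite inE.
    by rewrite inE => -[/= -> ->]; rewrite !eqxx.
  apply: measurable_indic; have [m1 m2] := cmeas_entry R (0 : 'I_(1 + n)) 0.
  by apply: measurableI; rewrite -[X in measurable X]setTI; [apply: m1|apply: m2].
have I1 t U : `|(ent 0 U == c t)%:R| <= 1 :> R by case: eqP; rewrite ?normr1// normr0.
have iI t : mu.-integrable D (EFin \o (fun U => (ent 0 U == c t)%:R)).
  by apply: (@integrable_bounded _ _ _ _ _ mD _ 1) => //; apply: measurable_funTS.
pose p : R := E (fun U => (ent 0 U == 1)%:R).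
change (p = 0).
have pc t : E (fun U => (ent 0 U == c t)%:R) = p.
  rewrite -(@haar_invariant_Rintegral R _ mu hmu _ (fun U => (ent 0 U == c t)%:R) 1 (unitary_scalar _ (c1 t)))//.
  apply: eq_Rintegral => U _; congr (_%:R); rewrite /ent mul_scalar_mx mxE.
  have ct0 : c t != 0 by apply: contra_eq_neq (c1 t) => ->; rewrite mulr0 eq_sym oner_eq0.
  by rewrite -[X in _ == X]mulr1 (inj_eq (mulfI ct0)).
have p0 : 0 <= p by apply: Rintegral_ge0 => U _; rewrite ler0n.
apply/eqP; rewrite eq_le p0 andbT leNgt; apply/negP => pgt0.
have mp (m : nat) : m%:R * p <= 1.
  have [iS] := @Rintegral_sum _ _ mu _ mD _ (iota 0 m) _ iI.
  rewrite (eq_bigr (fun=> p)) // big_const_seq count_predT size_iota iter_addr_0 => H; rewrite mulr_natl -H.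
  rewrite -[leRHS](Rintegral_cst1 mD muD 1); apply: le_Rintegral => //; first exact: integrable_const.
  move=> U _; have := iota_uniq 0 m; elim: (iota 0 m) => [|t s IH]/=; first by rewrite big_nil.
  move=> /andP[ts us]; rewrite big_cons; case: eqP => [E0|_]; last by rewrite add0r IH.
  rewrite big_seq big1 ?addr0// => t' t's; case: eqP => // E1.
  by move: ts; rewrite (c_inj t t') ?t's// -E0 -E1.
have := mp (Num.truncn p^-1).+1.
have := truncnS_gt p^-1.
rewrite -(ltr_pM2r pgt0) mulVf ?gt_eqF// => h1 h2.
by have := lt_le_trans h1 h2; rewrite ltxx.
Qed.
End Moments.

(** * The recursion and the limit *)

Lemma absC_eq0 (R : realType) (z : R[i]) : (absC z == 0) = (z == 0).
Proof.
rewrite /absC sqrtr_eq0; case: z => a b; rewrite eq_complex /=.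
rewrite le_eqVlt ltNge addr_ge0 ?sqr_ge0//= orbF paddr_eq0 ?sqr_ge0//.
by rewrite !sqrf_eq0.
Qed.

Section Recursion.
Variables (R : realType) (k : nat) (mu : forall N : nat, probability (MatSpace R N) R).
Hypothesis hmu : forall N : nat, is_Haar_UN (mu N).
Local Notation C := R[i].
Local Notation D N := (@unitary_mx R N : set (MatSpace R N)).

Lemma measurable_eqC N (i j : 'I_N) (c : C) :
  measurable_fun setT (fun U : MatSpace R N => ((U : 'M[C]_N) i j == c)%:R : R).
Proof.
rewrite (_ : (fun U => _) = \1_((fun U : MatSpace R N => complex.Re ((U : 'M[C]_N) i j)) @^-1` [set complex.Re c] `&`
   (fun U : MatSpace R N => complex.Im ((U : 'M[C]_N) i j)) @^-1` [set complex.Im c])); last first.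
  apply/funext => U; rewrite indicE; congr ((nat_of_bool _)%:R); rewrite eq_complex.
  apply/idP/idP; first by move=> /andP[/eqP h1 /eqP h2]; rewrite inE.
  by rewrite inE => -[/= -> ->]; rewrite !eqxx.
apply: measurable_indic; have [m1 m2] := cmeas_entry R i j.
by apply: measurableI; rewrite -[X in measurable X]setTI; [apply: m1|apply: m2].
Qed.

Definition absdet N (U : MatSpace R N) : R := absC (\det (1%:M - (U : 'M[C]_N))).
Definition abscorner n (U : MatSpace R (1 + n)) : R := absC (1 - (U : 'M[C]_(1 + n)) 0 0).

Lemma absdet_ge0 N U : 0 <= @absdet N U. Proof. exact: absC_ge0. Qed.
Lemma abscorner_ge0 n U : 0 <= @abscorner n U. Proof. exact: absC_ge0. Qed.

Lemma measurable_absdet N : measurable_fun setT (@absdet N).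
Proof. by apply: measurable_absC; apply: cmeas_det1B => i j; exact: cmeas_entry. Qed.

Lemma measurable_abscorner n : measurable_fun setT (@abscorner n).
Proof.
apply: measurable_absC; apply: cmeasD; first exact: cmeas_cst.
by apply: cmeasN; exact: cmeas_entry.
Qed.

Lemma abscornerE n (U : MatSpace R (1 + n)) : abscorner U =
  Num.sqrt ((1 - complex.Re ((U : 'M[C]_(1 + n)) 0 0)) ^+ 2 + complex.Im ((U : 'M[C]_(1 + n)) 0 0) ^+ 2).
Proof.
rewrite /abscorner /absC; congr Num.sqrt; case: ((U : 'M[C]_(1 + n)) 0 0) => a b /=.
by rewrite sub0r sqrrN.
Qed.

Lemma abscorner_le2 n (U : MatSpace R (1 + n)) : D (1 + n) U -> abscorner U <= 2.
Proof.
move=> /(@unitary_entry_le1 _ _ _ 0 0) h; rewrite abscornerE.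
apply: (@norm1B_le2 _ _ _ (Num.sqrt (sqC ((U : 'M[C]_(1 + n)) 0 0)))) => //.
  by rewrite sqr_sqrtr ?sqC_ge0.
by rewrite -sqrtr1 ler_wsqrtr.
Qed.

Lemma measurable_weightf (g : R -> R) : measurable_fun setT g ->
  measurable_fun setT (fun z => weight k z * g (ln z)).
Proof.
move=> mg; apply: measurable_funM; first exact: measurable_weight.
exact: (measurableT_comp mg (@measurable_ln R)).
Qed.

Lemma weightf_mul (g : R -> R) (x y : R) : 0 <= x -> 0 <= y ->
  weight k (x * y) * g (ln (x * y)) = weight k y * (weight k x * g (ln y + ln x)).
Proof.
move=> x0 y0; rewrite weightM//.
move: x0; rewrite le_eqVlt => /predU1P[<-|x0].
  by rewrite /weight ltxx !mul0r mulr0.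
move: y0; rewrite le_eqVlt => /predU1P[<-|y0].
  by rewrite /weight ltxx mulr0 !mul0r.
by rewrite lnM ?posrE// [ln x + _]addrC; ring.
Qed.

(** The transfer operator of the recursion: [y] is the logarithm reached at size [n], to which the
    new factor adds its own. It is unnormalised and sends the constant 1 to [corner_mass n]. *)
Definition corner_int n (g : R -> R) (y : R) : R :=
  \int[mu (1 + n)]_(U in D (1 + n)) (weight k (abscorner U) * g (y + ln (abscorner U))).

Section OneStep.
Variable (n : nat) (g : R -> R).
Hypotheses (mg : measurable_fun setT g) (g01 : forall x, 0 <= g x <= 1).

Let mu1 := mu (1 + n).
Let mD1 : measurable (D (1 + n)) := measurable_unitary (hmu (1 + n)).

Lemma measurable_corner_arg y : measurable_fun setT (fun U => weight k (@abscorner n U) * g (y + ln (abscorner U))).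
Proof.
apply: measurable_funM.
  exact: (measurableT_comp (@measurable_weight R k) (@measurable_abscorner n)).
apply: (measurableT_comp mg); apply: measurable_funD; first exact: measurable_cst.
exact: (measurableT_comp (@measurable_ln R) (@measurable_abscorner n)).
Qed.

Lemma integrable_corner_arg y :
  mu1.-integrable (D (1 + n)) (EFin \o (fun U => weight k (@abscorner n U) * g (y + ln (abscorner U)))).
Proof.
apply: (@integrable_bounded _ _ _ _ _ mD1 _ (4 ^+ k * 1)).
  by apply: measurable_funTS; exact: measurable_corner_arg.
move=> U DU; apply: norm_leM; first by rewrite ger0_norm ?weight_ge0// weight_le// abscorner_le2.
by have /andP[? ?] := g01 (y + ln (abscorner U)); rewrite ger0_norm.
Qed.

(** [absdet_rec] for the function [weight k z * g (ln z)], which splits along products by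
    [weightf_mul]. Measurability of the inner integral comes from Tonelli and is recorded for the
    later integrability arguments. *)
Lemma corner_int_rec :
  measurable_fun setT (fun U' => weight k (@absdet n U') * corner_int n g (ln (absdet U'))) /\
  (\int[mu1]_U (weight k (@absdet (1 + n) U) * g (ln (absdet U)))%:E =
   \int[mu n]_U' (weight k (absdet U') * corner_int n g (ln (absdet U')))%:E)%E.
Proof.
pose F (p : MatSpace R (1 + n) * MatSpace R n) :=
  (weight k (absdet p.2) * (weight k (abscorner p.1) * g (ln (absdet p.2) + ln (abscorner p.1))))%:E.
have mfst : measurable_fun setT (fst : MatSpace R (1 + n) * MatSpace R n -> MatSpace R (1 + n)).
  exact: measurable_fst.
have msnd : measurable_fun setT (snd : MatSpace R (1 + n) * MatSpace R n -> MatSpace R n).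
  exact: measurable_snd.
have mX := measurableT_comp (@measurable_abscorner n) mfst.
have mZ := measurableT_comp (@measurable_absdet n) msnd.
have mF : measurable_fun setT F.
  apply/measurable_EFinP; apply: measurable_funM.
    exact: (measurableT_comp (@measurable_weight R k) mZ).
  apply: measurable_funM.
    exact: (measurableT_comp (@measurable_weight R k) mX).
  apply: (measurableT_comp mg); apply: measurable_funD.
    exact: (measurableT_comp (@measurable_ln R) mZ).
  exact: (measurableT_comp (@measurable_ln R) mX).
have F0 p : (0 <= F p)%E.
  by rewrite lee_fin !mulr_ge0 ?weight_ge0//; have /andP[] := g01 (ln (absdet p.2) + ln (abscorner p.1)).
have corner_intE U' : (\int[mu1]_U F (U, U') = (weight k (absdet U') * corner_int n g (ln (absdet U')))%:E)%E.
  rewrite EFinM /corner_int /Rintegral fineK; last first.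
    by apply: integrable_fin_num => //; exact: integrable_corner_arg.
  rewrite -ge0_integralZl//; last 3 first.
  - by apply/measurable_EFinP; apply: measurable_funTS; exact: measurable_corner_arg.
  - move=> U _; rewrite lee_fin mulr_ge0 ?weight_ge0//.
    by have /andP[] := g01 (ln (absdet U') + ln (abscorner U)).
  - by rewrite lee_fin weight_ge0.
  rewrite (haar_integral_unitary (hmu (1 + n))).
  - by apply: eq_integral => U _; rewrite -EFinM.
  - have h : measurable_fun setT (fun U => weight k (absdet U') * (weight k (@abscorner n U) * g (ln (absdet U') + ln (abscorner U)))).
      by apply: measurable_funM; [exact: measurable_cst|exact: measurable_corner_arg].
    by apply/measurable_EFinP; exact: h.
  - by move=> U; exact: F0.
split.
  apply/measurable_EFinP.
  have := @measurable_fun_fubini_tonelli_G _ _ _ _ R mu1 F mF F0.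
  by rewrite (_ : fubini_G _ _ = fun U' => (weight k (absdet U') * corner_int n g (ln (absdet U')))%:E)//;
    apply/funext => U'; exact: corner_intE.
pose f z := weight k z * g (ln z).
have mf : measurable_fun setT f by exact: measurable_weightf.
have f0 z : 0 <= f z by rewrite mulr_ge0 ?weight_ge0//; have /andP[] := g01 (ln z).
rewrite [LHS](absdet_rec (hmu (1 + n)) (hmu n) mf f0).
under [RHS]eq_integral do rewrite -corner_intE.
transitivity (\int[mu1]_U \int[mu n]_U' F (U, U'))%E.
  apply: eq_integral => U _; apply: eq_integral => U' _.
  by rewrite /f weightf_mul ?absC_ge0.
exact: (fubini_tonelli F mF F0).
Qed.
End OneStep.

Definition corner_mass n : R := \int[mu (1 + n)]_(U in D (1 + n)) weight k (@abscorner n U).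

Lemma corner_int1 n y : corner_int n (fun=> 1) y = corner_mass n.
Proof. by apply: eq_Rintegral => U _; rewrite mulr1. Qed.

Lemma absdet0 (U : MatSpace R 0) : absdet U = 1.
Proof. by rewrite /absdet det_mx00 /absC /= expr0n addr0 expr1n sqrtr1. Qed.

Lemma weight1 : weight k 1 = 1 :> R.
Proof. by rewrite /weight ltr01 expr1n. Qed.

(** Induction along the recursion with [g = 1]: one step multiplies the integral by the finite
    number [corner_mass]. *)
Lemma integrable_weight N : (mu N).-integrable setT (EFin \o (fun U => weight k (@absdet N U))).
Proof.
elim: N => [|n IH].
  rewrite (_ : (fun U => _) = fun=> 1); last by apply/funext => U; rewrite absdet0 weight1.
  exact: integrable_const.
apply/integrableP; split.
  by apply/measurable_EFinP; exact: (measurableT_comp (@measurable_weight R k) (@measurable_absdet n.+1)).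
have c01 (x : R) : 0 <= (fun=> 1 : R) x <= 1 by rewrite ler01 lexx.
have [_ H] := @corner_int_rec n (fun=> 1) (measurable_cst _) c01.
rewrite (eq_integral (fun U => (weight k (@absdet (1 + n) U) * 1)%:E)); last first.
  by move=> U _ /=; rewrite ger0_norm ?weight_ge0// mulr1.
rewrite [ltLHS]H; under eq_integral do rewrite corner_int1 mulrC.
have := @integrableZ R _ _ (mu n) setT measurableT _ (corner_mass n) IH.
move=> /integrableP[_]; apply: le_lt_trans.
apply: ge0_le_integral => //=.
- move=> U _; rewrite lee_fin mulr_ge0 ?weight_ge0// Rintegral_ge0// => V _.
  exact: weight_ge0.
- apply/measurable_EFinP; apply: measurable_funM; first exact: measurable_cst.
  exact: (measurableT_comp (@measurable_weight R k) (@measurable_absdet n)).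
- apply/measurable_EFinP; apply: measurableT_comp => //.
  apply: measurable_funM; first exact: measurable_cst.
  exact: (measurableT_comp (@measurable_weight R k) (@measurable_absdet n)).
- by move=> U _; rewrite lee_fin ler_norm.
Qed.

Lemma integrable_weightM N (h : MatSpace R N -> R) (M : R) :
  measurable_fun setT (fun U => weight k (absdet U) * h U) -> (forall U, `|h U| <= M) ->
  (mu N).-integrable setT (EFin \o (fun U => weight k (@absdet N U) * h U)).
Proof.
move=> mh hM; have := @integrableZ R _ _ (mu N) setT measurableT _ M (@integrable_weight N).
apply: le_integrable => //; first exact/measurable_EFinP.
move=> U _; rewrite lee_fin mulrC !normrM ler_wpM2r//.
by rewrite (le_trans (hM U))// ler_norm.
Qed.

Definition wint N (g : R -> R) : R := \int[mu N]_U (weight k (@absdet N U) * g (ln (absdet U))).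

Lemma integrable_wint N (g : R -> R) (M : R) : measurable_fun setT g -> (forall x, `|g x| <= M) ->
  (mu N).-integrable setT (EFin \o (fun U => weight k (@absdet N U) * g (ln (absdet U)))).
Proof.
move=> mg gM; apply: (@integrable_weightM _ _ M) => //.
exact: (measurableT_comp (measurable_weightf mg) (@measurable_absdet N)).
Qed.

Lemma le_wint N (g1 g2 : R -> R) (M1 M2 : R) : measurable_fun setT g1 -> (forall x, `|g1 x| <= M1) ->
  measurable_fun setT g2 -> (forall x, `|g2 x| <= M2) -> (forall x, g1 x <= g2 x) ->
  wint N g1 <= wint N g2.
Proof.
move=> m1 b1 m2 b2 g12; apply: le_Rintegral => //.
- exact: integrable_wint b1.
- exact: integrable_wint b2.
- by move=> U _; rewrite ler_wpM2l ?weight_ge0.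
Qed.

(** A uniform bound on the one-step error is integrated against the weight at size [n], so it is
    multiplied by the total mass there and becomes a relative error. *)
Lemma wint_step n (g gt : R -> R) (e : R) :
  measurable_fun setT g -> (forall x, 0 <= g x <= 1) ->
  measurable_fun setT gt -> (forall x, 0 <= gt x <= 1) ->
  (forall y, `|corner_int n g y - corner_mass n * gt y| <= e) ->
  `|wint n.+1 g - corner_mass n * wint n gt| <= e * wint n (fun=> 1).
Proof.
move=> mg g01 mgt gt01 H.
have [mi E] := corner_int_rec n mg g01.
have gt1 x : `|gt x| <= 1 by have /andP[? ?] := gt01 x; rewrite ger0_norm.
have ig := integrable_wint n mgt gt1.
have pg : corner_mass n * wint n gt = \int[mu n]_U (weight k (absdet U) * (corner_mass n * gt (ln (absdet U)))).
  by rewrite /wint -RintegralZl//; apply: eq_Rintegral => U _; rewrite mulrCA.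
have ii : (mu n).-integrable setT (EFin \o (fun U => weight k (@absdet n U) * corner_int n g (ln (absdet U)))).
  apply: (@integrable_weightM _ _ (e + `|corner_mass n| * 1)) => // U.
  rewrite -[corner_int _ _ _](subrK (corner_mass n * gt (ln (absdet U)))).
  by apply: norm_leD; [exact: H|exact: norm_leM].
have ip : (mu n).-integrable setT (EFin \o (fun U => weight k (@absdet n U) * (corner_mass n * gt (ln (absdet U))))).
  have := @integrableZ R _ _ (mu n) setT measurableT _ (corner_mass n) ig.
  by apply: eq_integrable => // U _ /=; rewrite mulrCA.
have -> : wint n.+1 g = \int[mu n]_U (weight k (absdet U) * corner_int n g (ln (absdet U))).
  by rewrite /wint /Rintegral; congr fine; exact: E.
rewrite pg -RintegralB//.
have -> : e * wint n (fun=> 1) = \int[mu n]_U (e * weight k (absdet U)).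
  rewrite RintegralZl//; last exact: integrable_weight.
  by congr (_ * _); apply: eq_Rintegral => U _; rewrite mulr1.
apply: norm_Rintegral_le => //.
- exact: integrable_diff.
- by apply: integrableZ => //; exact: integrable_weight.
- move=> U _; rewrite -mulrBr normrM ger0_norm ?weight_ge0// mulrC.
  by rewrite ler_wpM2r ?weight_ge0.
Qed.

Lemma wint1_rec n : wint n.+1 (fun=> 1) = corner_mass n * wint n (fun=> 1).
Proof.
apply/eqP; rewrite -subr_eq0 -normr_le0 -[leRHS](mul0r (wint n (fun=> 1))).
apply: wint_step => //; try by move=> x; rewrite ler01 lexx.
by move=> y; rewrite corner_int1 mulr1 subrr normr0.
Qed.

Lemma bernoulli_ineq (w : R) (m : nat) : -1 <= w -> 1 + m%:R * w <= (1 + w) ^+ m.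
Proof.
move=> w1; elim: m => [|m IH]; first by rewrite mul0r addr0 expr0.
rewrite exprS; have h : 0 <= 1 + w by lra.
apply: le_trans (ler_wpM2l h IH).
rewrite -natr1; have := mulr_ge0 (ler0n R m) (sqr_ge0 w); nra.
Qed.

(** By Bernoulli, [|1 - u|^(2k) >= 1 + k (|u|^2 - 2 Re u)], whose mean is [1 + k / N]. At [u = 1]
    the weight is 0 even for [k = 0]; the indicator subtracted there has mean zero by [haar_ne1]. *)
Lemma corner_mass_ge1 n : 1 <= corner_mass n.
Proof.
have mD := measurable_unitary (hmu (1 + n)).
have hD := haar_unitary (hmu (1 + n)).
pose u (U : MatSpace R (1 + n)) : C := (U : 'M[C]_(1 + n)) 0 0.
have [mRe mIm] := cmeas_entry R (0 : 'I_(1 + n)) 0.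
have E1 : \int[mu (1 + n)]_(U in D (1 + n)) complex.Re (u U) = 0 := haar_mean0 (hmu (1 + n)).
have E2 : \int[mu (1 + n)]_(U in D (1 + n)) sqC (u U) = (1 + n)%:R^-1 := haar_sq (hmu (1 + n)).
have E3 : \int[mu (1 + n)]_(U in D (1 + n)) (u U == 1)%:R = 0 := haar_ne1 (hmu (1 + n)).
have u1 U : D (1 + n) U -> sqC (u U) <= 1 by exact: unitary_entry_le1.
have i1 : (mu (1 + n)).-integrable (D (1 + n)) (EFin \o (fun U => complex.Re (u U))).
  apply: (@integrable_bounded _ _ _ _ _ mD _ 1); first exact: measurable_funTS.
  move=> U DU; rewrite -(@expr_le1 _ 2)// real_normK ?num_real//.
  by apply: le_trans (u1 U DU); rewrite lerDl sqr_ge0.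
have i2 : (mu (1 + n)).-integrable (D (1 + n)) (EFin \o (fun U => sqC (u U))).
  apply: (@integrable_bounded _ _ _ _ _ mD _ 1).
    by apply: measurable_funTS; apply: measurable_sqC_cmeas.
  by move=> U DU; rewrite ger0_norm ?sqC_ge0// u1.
have i3 : (mu (1 + n)).-integrable (D (1 + n)) (EFin \o (fun U => (u U == 1)%:R)).
  apply: (@integrable_bounded _ _ _ _ _ mD _ 1).
    by apply: measurable_funTS; exact: measurable_eqC.
  by move=> U DU; case: eqP; rewrite ?normr1// normr0.
have i0 := @integrable_const R _ _ (mu (1 + n)) _ mD 1.
have j1 := integrableZ mD (- (2 * k%:R)) i1.
have j2 := integrableZ mD k%:R i2.
have j01 := integrable_addf mD i0 j1.
have j012 := integrable_addf mD j01 j2.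
have -> : 1 = \int[mu (1 + n)]_(U in D (1 + n))
    (1 + - (2 * k%:R) * complex.Re (u U) + k%:R * sqC (u U) - (u U == 1)%:R) - k%:R / (1 + n)%:R.
  rewrite RintegralB// RintegralD// RintegralD// !RintegralZl// E1 E2 E3 (Rintegral_cst1 mD hD).
  by ring.
rewrite lerBlDr; apply: le_trans (_ : corner_mass n <= _); last by rewrite lerDl divr_ge0.
apply: le_Rintegral => //.
- exact: integrable_diff.
- apply: (@integrable_bounded _ _ _ _ _ mD _ (4 ^+ k)).
    apply: measurable_funTS.
    exact: (measurableT_comp (@measurable_weight R k) (@measurable_abscorner n)).
  by move=> U DU; rewrite ger0_norm ?weight_ge0// weight_le// abscorner_le2.
move=> U DU.
have X2 : abscorner U ^+ 2 = 1 + (- (2 * complex.Re (u U)) + sqC (u U)).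
  rewrite abscornerE sqr_sqrtr ?addr_ge0 ?sqr_ge0// -/(u U) /sqC; ring.
have := abscorner_ge0 U; rewrite le_eqVlt => /predU1P[X0|X0].
  have -> : u U = 1.
    move: X2; rewrite -X0 expr0n/=; case: (u U) => a b; rewrite /sqC/= => h.
    have h2 : (1 - a) ^+ 2 + b ^+ 2 = 0.
      by transitivity (1 + (- (2 * a) + (a ^+ 2 + b ^+ 2))); [ring|exact/esym].
    move/eqP: h2; rewrite paddr_eq0 ?sqr_ge0// !sqrf_eq0 subr_eq0 => /andP[/eqP <- /eqP ->].
    by apply/eqP; rewrite eq_complex/= !eqxx.
  by rewrite eqxx /sqC/= (le_trans _ (weight_ge0 _ _))//; have := ler0n R k; nra.
rewrite /weight X0 exprM X2.
apply: le_trans (bernoulli_ineq k _); last first.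
  by have := sqr_ge0 (abscorner U); rewrite X2; lra.
by rewrite (_ : 1 + k%:R * _ = 1 + - (2 * k%:R) * complex.Re (u U) + k%:R * sqC (u U)) ?gerBl//; ring.
Qed.

Lemma wint1_ge1 N : 1 <= wint N (fun=> 1).
Proof.
elim: N => [|n IH].
  rewrite /wint (@eq_Rintegral _ _ _ _ _ (fun=> 1)); last by move=> U _; rewrite absdet0 weight1 mulr1.
  by rewrite Rintegral_cst// mul1r (_ : fine _ = 1)//; rewrite -[RHS]/(fine 1%E); congr fine; exact: probability_setT.
by rewrite wint1_rec -[leLHS]mul1r ler_pM// corner_mass_ge1.
Qed.

(** The recursion for the indicator of 0: a product vanishes only with one of its factors, and
    [haar_ne1] excludes the corner. *)
Lemma absdet_ne0 N : (\int[mu N]_U ((@absdet N U == 0)%:R : R)%:E = 0)%E.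
Proof.
have meq : measurable_fun setT (fun z : R => (z == 0)%:R : R).
  rewrite (_ : (fun z => _) = \1_[set 0]); first exact: measurable_indic.
  apply/funext => z; rewrite indicE; congr ((nat_of_bool _)%:R).
  by apply/idP/idP; rewrite inE => /eqP.
elim: N => [|n IH].
  by rewrite (eq_integral (fun=> 0%E)) ?integral0// => U _; rewrite absdet0 oner_eq0.
rewrite [LHS](absdet_rec (hmu (1 + n)) (hmu n) meq (fun z => ler0n _ _)).
pose u (U : MatSpace R (1 + n)) : C := (U : 'M[C]_(1 + n)) 0 0.
rewrite (eq_integral (fun U => ((u U == 1)%:R : R)%:E)); last first.
  move=> U _; rewrite -/(u U).
  have [->|u1] := eqVneq (u U) 1.
    rewrite subrr (eq_integral (fun=> 1%E)); last first.
      by move=> U' _; rewrite (eqP (_ : absC 0 == 0)) ?absC_eq0// mul0r eqxx.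
    by rewrite integral_cst// mul1e; exact: probability_setT.
  rewrite -[RHS]IH; apply: eq_integral => U' _; congr ((nat_of_bool _)%:R%:E).
  by rewrite mulf_eq0 absC_eq0 subr_eq0 eq_sym (negbTE u1).
have mu1 : measurable_fun setT (fun U => (u U == 1)%:R : R) by exact: measurable_eqC.
rewrite (haar_integral_unitary (hmu (1 + n))); last 2 first.
  by apply/measurable_EFinP.
  by move=> U; rewrite lee_fin.
have := haar_ne1 (hmu (1 + n)); rewrite /Rintegral => h.
rewrite -[LHS]fineK; first by congr EFin; exact: h.
apply: integrable_fin_num; first exact: (measurable_unitary (hmu (1 + n))).
apply: (@integrable_bounded _ _ _ _ _ (measurable_unitary (hmu (1 + n))) _ 1).
  exact: measurable_funTS.
by move=> U _; case: eqP; rewrite ?normr1// normr0.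
Qed.
End Recursion.

(** * Replacement of the increments and passage to the limit *)

Section Limit.
Variables (R : realType) (k : nat) (mu : forall N : nat, probability (MatSpace R N) R).
Hypothesis hmu : forall N : nat, is_Haar_UN (mu N).
Local Notation C := R[i].
Local Notation D N := (@unitary_mx R N : set (MatSpace R N)).
Local Notation wint := (wint k mu).
Local Notation corner_mass := (corner_mass k mu).
Local Notation Q := (@gauss_tail R).

(** Left invariance under the scalar [expmi theta] removes the angle. Passing from the power to
    [weight] matters only where the determinant vanishes, a null event. *)
Lemma weighted_massE N (theta : R) (B : set R) : measurable B ->
  fine (\int[mu N]_(U in [set U | B (ln (absZ theta (U : 'M[C]_N)))])
    ((absZ theta (U : 'M[C]_N)) ^+ (2 * k))%:E)%E = wint N (\1_B).
Proof.
move=> mB; rewrite /wint /Rintegral; congr fine.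
pose F (z : R) : R := z ^+ (2 * k) * \1_B (ln z).
have mF : measurable_fun setT F.
  apply: measurable_funM; first exact: measurable_funX.
  exact: (measurableT_comp (measurable_indic mB) (@measurable_ln R)).
have I01 z : (0 : R) <= \1_B z <= (1 : R) by rewrite indicE; case: (_ \in _); rewrite ?ler01 ?lexx.
have F0 z : 0 <= F z.
  by have /andP[? _] := I01 (ln z); rewrite mulr_ge0// exprM exprn_ge0// sqr_ge0.
have mFZ : measurable_fun setT (fun U => (F (@absdet R N U))%:E).
  by apply/measurable_EFinP; exact: (measurableT_comp mF (@measurable_absdet R N)).
have -> : (\int[mu N]_(U in [set U | B (ln (absZ theta (U : 'M[C]_N)))])
    ((absZ theta (U : 'M[C]_N)) ^+ (2 * k))%:E = \int[mu N]_U (F (absZ theta (U : 'M[C]_N)))%:E)%E.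
  rewrite integral_mkcond; apply: eq_integral => U _; rewrite patchE /F indicE.
  rewrite (_ : (U \in _) = (ln (absZ theta (U : 'M[C]_N)) \in B)); last by apply/idP/idP; rewrite !inE.
  by case: (_ \in B); rewrite ?mulr1 ?mulr0.
have hV : unitary_mx ((expmi theta)%:M : 'M[C]_N).
  apply: unitary_scalar; apply/eqP; rewrite eq_complex/=; apply/andP; split; apply/eqP; last by ring.
  by rewrite -(cos2Dsin2 theta); ring.
have FZ0 U : (0 <= (F (@absdet R N U))%:E)%E by rewrite lee_fin.
transitivity (\int[mu N]_U (F (absdet U))%:E)%E.
  transitivity (\int[mu N]_U (F (absdet ((expmi theta)%:M *m (U : 'M[C]_N))))%:E)%E.
    by apply: eq_integral => U _; rewrite /absdet mul_scalar_mx.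
  exact: (haar_invariant_ge0 (hmu N) hV mFZ FZ0).
(* At [z = 0] the left side is 0, while the power may be 1 when [k = 0]; the indicator covers this
   case. *)
have Zc (z : R) : 0 <= z -> weight k z * \1_B (ln z) <= F z <= weight k z * \1_B (ln z) + (z == 0)%:R.
  have /andP[i0 i1] := I01 (ln z).
  rewrite le_eqVlt => /predU1P[<-|z0].
    rewrite /weight ltxx mul0r add0r F0 eqxx /F mulr_ile1// ?exprn_ge0//; first by rewrite exprn_ile1.
  by rewrite /weight z0 (gt_eqF z0) addr0 lexx.
have mw : measurable_fun setT (fun U => weight k (@absdet R N U) * \1_B (ln (absdet U))).
  exact: (measurableT_comp (measurable_weightf k (measurable_indic mB)) (@measurable_absdet R N)).
have w0 U : 0 <= weight k (@absdet R N U) * \1_B (ln (absdet U)).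
  by rewrite mulr_ge0 ?weight_ge0//; have /andP[] := I01 (ln (absdet U)).
have meq : measurable_fun setT (fun U : MatSpace R N => (absdet U == 0)%:R : R).
  have h : measurable_fun setT (fun z : R => (z == 0)%:R : R).
    rewrite (_ : (fun z => _) = \1_[set 0]); first exact: measurable_indic.
    apply/funext => z; rewrite indicE; congr ((nat_of_bool _)%:R).
    by apply/idP/idP; rewrite inE => /eqP.
  exact: (measurableT_comp h (@measurable_absdet R N)).
apply/eqP; rewrite eq_le; apply/andP; split; last first.
  apply: ge0_le_integral => //.
  - by move=> U _; rewrite lee_fin.
  - exact/measurable_EFinP.
  - by move=> U _; rewrite lee_fin; have /andP[] := Zc _ (absdet_ge0 U).
apply: (@le_trans _ _ (\int[mu N]_U ((weight k (absdet U) * \1_B (ln (absdet U)))%:E + ((absdet U == 0)%:R)%:E))%E).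
  apply: ge0_le_integral => //.
  - by apply: emeasurable_funD; exact/measurable_EFinP.
  - by move=> U _; rewrite -EFinD lee_fin; have /andP[] := Zc _ (absdet_ge0 U).
rewrite ge0_integralD//.
- by rewrite (absdet_ne0 hmu) adde0.
- by move=> U _; rewrite lee_fin.
- exact/measurable_EFinP.
- exact/measurable_EFinP.
Qed.

Definition wmean N (g : R -> R) : R := wint N g / wint N (fun=> 1).

Lemma wint1_gt0 N : 0 < wint N (fun=> 1).
Proof. exact: lt_le_trans ltr01 (wint1_ge1 k hmu N). Qed.

Lemma le_wmean N (g1 g2 : R -> R) (M1 M2 : R) : measurable_fun setT g1 -> (forall x, `|g1 x| <= M1) ->
  measurable_fun setT g2 -> (forall x, `|g2 x| <= M2) -> (forall x, g1 x <= g2 x) ->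
  wmean N g1 <= wmean N g2.
Proof.
move=> m1 b1 m2 b2 g12; rewrite /wmean ler_wpM2r ?invr_ge0 ?(ltW (wint1_gt0 N))//.
exact: (@le_wint R k mu hmu N g1 g2 M1 M2).
Qed.

Lemma wmeanDc N (g : R -> R) (M c : R) : measurable_fun setT g -> (forall x, `|g x| <= M) ->
  wmean N (fun x => g x + c) = wmean N g + c.
Proof.
move=> mg gM; rewrite /wmean -[c in RHS](mulfK (lt0r_neq0 (wint1_gt0 N))) -mulrDl; congr (_ / _).
rewrite /wint -RintegralZl//; last by apply: (@integrable_wint R k mu hmu N (fun=> 1) 1) => // x; rewrite normr1.
rewrite -RintegralD//.
- by apply: eq_Rintegral => U _; ring.
- exact: (@integrable_wint R k mu hmu N g M).
- apply: integrableZ => //.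
  by apply: (@integrable_wint R k mu hmu N (fun=> 1) 1) => // x; rewrite normr1.
Qed.

Lemma measurable_gauss_arg (c sg : R) : measurable_fun setT (fun x : R => Q ((c - x) / sg)).
Proof.
apply: (measurableT_comp (@measurable_gauss_tail R)); apply: measurable_funM => //.
exact: measurable_funB.
Qed.

Lemma gauss_arg01 (c sg x : R) : 0 <= Q ((c - x) / sg) <= 1.
Proof. by rewrite gauss_tail_ge0 gauss_tail_le1. Qed.

Lemma gauss_arg_norm (c sg x : R) : `|Q ((c - x) / sg)| <= 1.
Proof. by rewrite ger0_norm ?gauss_tail_ge0// gauss_tail_le1. Qed.

(** [step_bound] at size [n + 1], so [2 <= n] is its condition [3 <= N]. The drift
    [k (ln (n + 1) - ln n)] turns the centring [k ln (n + 1)] into [k ln n], and division by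
    [corner_mass >= 1] keeps the error. *)
Lemma wmean_step n (c sg : R) : (2 <= n)%N -> 1 <= sg ->
  `|wmean n.+1 (fun x => Q ((c + k%:R * ln n.+1%:R - x) / sg)) -
    wmean n (fun x => Q ((c + k%:R * ln n%:R - x) / Num.sqrt (sg ^+ 2 + (ln n.+1%:R - ln n%:R) / 2)))|
  <= step_const R k / (n.+1%:R * Num.sqrt n.+1%:R).
Proof.
move=> n2 sg1.
pose u (U : MatSpace R (1 + n)) : C := (U : 'M[C]_(1 + n)) 0 0.
have mD := measurable_unitary (hmu (1 + n)).
have hD := haar_unitary (hmu (1 + n)).
have [mRe mIm] := cmeas_entry R (0 : 'I_(1 + n)) 0.
have E1 : \int[mu (1 + n)]_(U in D (1 + n)) complex.Re (u U) = 0 := haar_mean0 (hmu (1 + n)).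
have E2 : \int[mu (1 + n)]_(U in D (1 + n)) sqC (u U) = (1 + n)%:R^-1 := haar_sq (hmu (1 + n)).
have E3 : \int[mu (1 + n)]_(U in D (1 + n)) complex.Re (u U) ^+ 2 =
  \int[mu (1 + n)]_(U in D (1 + n)) complex.Im (u U) ^+ 2 := haar_Re2_Im2 (hmu (1 + n)).
have E4 : \int[mu (1 + n)]_(U in D (1 + n)) (complex.Re (u U) ^+ 2 + complex.Im (u U) ^+ 2) ^+ 2
   <= 2 / (1 + n)%:R ^+ 2 := haar_sq2 (hmu (1 + n)).
have u1 U : D (1 + n) U -> complex.Re (u U) ^+ 2 + complex.Im (u U) ^+ 2 <= 1.
  exact: unitary_entry_le1.
have i1 : (mu (1 + n)).-integrable (D (1 + n)) (EFin \o (fun U => complex.Re (u U) ^+ 2)).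
  apply: (@integrable_bounded _ _ _ _ _ mD _ 1).
    by apply: measurable_funTS; exact: measurable_funX.
  by move=> U DU; rewrite ger0_norm ?sqr_ge0// (le_trans _ (u1 U DU))// lerDl sqr_ge0.
have i2 : (mu (1 + n)).-integrable (D (1 + n)) (EFin \o (fun U => complex.Im (u U) ^+ 2)).
  apply: (@integrable_bounded _ _ _ _ _ mD _ 1).
    by apply: measurable_funTS; exact: measurable_funX.
  by move=> U DU; rewrite ger0_norm ?sqr_ge0// (le_trans _ (u1 U DU))// lerDr sqr_ge0.
have E2' : \int[mu (1 + n)]_(U in D (1 + n)) complex.Re (u U) ^+ 2 = (2 * (1 + n)%:R)^-1.
  move: E2; rewrite /sqC RintegralD// -E3 => h.
  by rewrite invfM -h; field.
have E2'' : \int[mu (1 + n)]_(U in D (1 + n)) complex.Im (u U) ^+ 2 = (2 * (1 + n)%:R)^-1.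
  by rewrite -E3.
have SB y := @step_bound R _ _ (mu (1 + n)) (D (1 + n)) (fun U => complex.Re (u U))
  (fun U => complex.Im (u U)) (1 + n) k mD hD (measurable_funTS mRe) (measurable_funTS mIm) u1
  n2 E1 E2' E2'' E4 sg (c + k%:R * ln n.+1%:R - y) sg1.
have n1 : (1 + n)%:R - 1 = n%:R :> R by rewrite natrD addrAC subrr add0r.
pose gt (x : R) := Q ((c + k%:R * ln n%:R - x) / Num.sqrt (sg ^+ 2 + (ln n.+1%:R - ln n%:R) / 2)).
pose g (x : R) := Q ((c + k%:R * ln n.+1%:R - x) / sg).
change (`|wmean n.+1 g - wmean n gt| <= step_const R k / (n.+1%:R * Num.sqrt n.+1%:R)).
have := @wint_step R k mu hmu n g gt (step_const R k / (n.+1%:R * Num.sqrt n.+1%:R)) (measurable_gauss_arg _ _)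
  (gauss_arg01 _ _) (measurable_gauss_arg _ _) (gauss_arg01 _ _).
have H y : `|corner_int k mu n g y - corner_mass n * gt y| <= step_const R k / (n.+1%:R * Num.sqrt n.+1%:R).
  have h := SB y.
  rewrite n1 -[(1 + n)%:R]/(n.+1%:R : R) in h.
  have -> : corner_mass n = \int[mu (1 + n)]_(U in D (1 + n)) weight k (Num.sqrt ((1 - complex.Re (u U)) ^+ 2 + complex.Im (u U) ^+ 2)).
    by apply: eq_Rintegral => U _; rewrite abscornerE.
  have -> : corner_int k mu n g y = \int[mu (1 + n)]_(U in D (1 + n))
      (weight k (Num.sqrt ((1 - complex.Re (u U)) ^+ 2 + complex.Im (u U) ^+ 2)) *
       Q ((c + k%:R * ln n.+1%:R - y - ln (Num.sqrt ((1 - complex.Re (u U)) ^+ 2 + complex.Im (u U) ^+ 2))) / sg)).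
    by apply: eq_Rintegral => U _; rewrite abscornerE /g opprD addrA.
  have e1 : c + k%:R * ln n.+1%:R - y - k%:R * (ln n.+1%:R - ln n%:R) = c + k%:R * ln n%:R - y by ring.
  rewrite e1 in h; exact: h.
move=> /(_ H); rewrite /wmean wint1_rec//.
have p1 := corner_mass_ge1 k hmu n; have a0 := wint1_gt0 n.
have p0 : 0 < corner_mass n by exact: lt_le_trans ltr01 p1.
move=> H2.
rewrite (_ : _ - _ = (wint n.+1 g - corner_mass n * wint n gt) / (corner_mass n * wint n (fun=> 1))); last first.
  by field; rewrite !gt_eqF.
rewrite normrM [X in _ * X]ger0_norm ?invr_ge0 ?mulr_ge0 ?(ltW p0) ?(ltW a0)//.
rewrite ler_pdivrMr ?mulr_gt0// (le_trans H2)// mulrA ler_wpM2r ?(ltW a0)//.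
rewrite ler_peMr//; exact: le_trans (normr_ge0 _) (H 0).
Qed.

(** With [x], [y] the two roots, [y ^+ 2 - x ^+ 2 = 1] gives [x^-1 - y^-1 = (x y (x + y))^-1], and
    [x <= y] bounds this below by half of [y ^- 3]. *)
Lemma sqrt_telescope n : (0 < n)%N ->
  (n.+1%:R * Num.sqrt n.+1%:R)^-1 <= 2 * ((Num.sqrt n%:R)^-1 - (Num.sqrt n.+1%:R)^-1) :> R.
Proof.
move=> n0; set x := Num.sqrt n%:R; set y := Num.sqrt n.+1%:R.
have x0 : 0 < x by rewrite sqrtr_gt0 ltr0n.
have y0 : 0 < y by rewrite sqrtr_gt0 ltr0n.
have xy : x <= y by rewrite ler_wsqrtr// ler_nat.
have y2 : y ^+ 2 = x ^+ 2 + 1 by rewrite !sqr_sqrtr ?ler0n// natr1.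
have -> : n.+1%:R = y ^+ 2 by rewrite sqr_sqrtr.
have -> : x^-1 - y^-1 = (x * y * (x + y))^-1.
  have xy0 : x + y != 0 by rewrite gt_eqF// addr_gt0.
  apply: (mulIf (_ : x * y * (x + y) != 0)); first by rewrite !mulf_neq0// gt_eqF.
  rewrite mulVf; last by rewrite !mulf_neq0// gt_eqF.
  transitivity (y ^+ 2 - x ^+ 2); last by rewrite y2; ring.
  by field; rewrite !gt_eqF.
rewrite -[2]invrK -invfM lef_pV2 ?posrE ?mulr_gt0 ?invr_gt0 ?exprn_gt0 ?addr_gt0//.
have : x * y <= y * y by rewrite ler_wpM2r// ltW.
have := ltW y0; have := ltW x0; rewrite expr2.
move=> ? ? ?; have : x * y * (x + y) <= y * y * (y + y) by rewrite ler_pM ?mulr_ge0 ?addr_ge0// lerD2r.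
lra.
Qed.

Section Telescope.
Variables (N : nat) (V dl : R).
Let s2 : R := ln N%:R / 2.
Hypothesis N0 : (0 < N)%N.
Hypothesis s2_ge : 1 <= dl ^+ 2 * s2.

(** The variance of the test function once all increments of index above [j] have been replaced: it
    is [dl ^+ 2 * ln N / 2] at [j = N] and grows as [j] decreases. [heat_profile] is the test
    function at that stage, and [s2_ge] keeps its scale at least 1. *)
Definition heat_time j : R := dl ^+ 2 * (ln N%:R / 2) + (ln N%:R - ln j%:R) / 2.
Definition heat_profile j (x : R) : R :=
  Q ((V * Num.sqrt (ln N%:R / 2) + k%:R * ln j%:R - x) / Num.sqrt (heat_time j)).

Lemma heat_time_ge1 j : (0 < j <= N)%N -> 1 <= heat_time j.
Proof.
move=> /andP[j0 jN]; apply: le_trans s2_ge _; rewrite /heat_time lerDl divr_ge0// subr_ge0.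
by rewrite ler_ln ?posrE ?ltr0n// ler_nat.
Qed.

Lemma step_const_ge0 : 0 <= step_const R k.
Proof.
rewrite /step_const !addr_ge0// ?mulr_ge0// ?addr_ge0// ?exprn_ge0// ?mulr_ge0//; exact: mass_const_ge0.
Qed.

(** The bound is at most a constant over [sqrt M], uniformly in [N], so [M] can be fixed before [N]
    tends to infinity. *)
Lemma telescope M m : (2 <= M)%N -> (M + m <= N)%N ->
  `|wmean (M + m) (heat_profile (M + m)) - wmean M (heat_profile M)| <=
    2 * step_const R k * ((Num.sqrt M%:R)^-1 - (Num.sqrt (M + m)%:R)^-1).
Proof.
move=> M2; elim: m => [|m IH] MmN.
  by rewrite addn0 !subrr normr0 mulr0.
have /IH {}IH : (M + m <= N)%N by rewrite (leq_trans _ MmN)// leq_add2l.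
pose n := (M + m)%N.
have n2 : (2 <= n)%N by rewrite (leq_trans M2)// leq_addr.
have n0 : (0 < n)%N by rewrite (leq_trans _ n2).
have t1 : 1 <= heat_time n.+1 by apply: heat_time_ge1; rewrite /= -addnS.
have sg1 : 1 <= Num.sqrt (heat_time n.+1) by rewrite -[leLHS]sqrtr1 ler_wsqrtr.
have := wmean_step (V * Num.sqrt (ln N%:R / 2)) n2 sg1.
rewrite sqr_sqrtr ?(le_trans ler01 t1)//.
rewrite (_ : heat_time n.+1 + _ = heat_time n); last by rewrite /heat_time; field.
rewrite -/(heat_profile n.+1) -/(heat_profile n) => H.
have H2 : step_const R k / (n.+1%:R * Num.sqrt n.+1%:R) <=
    2 * step_const R k * ((Num.sqrt n%:R)^-1 - (Num.sqrt n.+1%:R)^-1).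
  by rewrite [2 * _]mulrC -mulrA ler_wpM2l ?step_const_ge0// sqrt_telescope.
rewrite addnS -/n in IH *.
have := norm_leD (le_trans H H2) IH.
rewrite addrA subrK => /le_trans; apply.
by lra.
Qed.
End Telescope.

(** Dominated convergence at fixed size [M], with the integrable weight as dominating function. *)
Lemma wint_cvg M (g_ : nat -> R -> R) (l : R) : (forall n, measurable_fun setT (g_ n)) ->
  (forall n x, `|g_ n x| <= 1) -> (forall x, g_ n x @[n --> \oo] --> l) ->
  wint M (g_ n) @[n --> \oo] --> wint M (fun=> l).
Proof.
move=> mg g1 gl; rewrite /wint /Rintegral.
have wl : (mu M).-integrable setT (EFin \o (fun U => weight k (@absdet R M U) * l)).
  exact: (@integrable_wint R k mu hmu M (fun=> l) `|l|).
have h1 n : measurable_fun setT (fun U => (weight k (@absdet R M U) * g_ n (ln (absdet U)))%:E).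
  apply/measurable_EFinP.
  exact: (measurableT_comp (measurable_weightf k (mg n)) (@measurable_absdet R M)).
have h2 : measurable_fun setT (fun U => (weight k (@absdet R M U) * l)%:E).
  by have /integrableP[] := wl.
have h3 : {ae mu M, forall U, setT U ->
    (fun n => (weight k (@absdet R M U) * g_ n (ln (absdet U)))%:E) @ \oo --> (weight k (@absdet R M U) * l)%:E}.
  apply: aeW => U _; apply: cvg_EFin; first by near=> n.
  by apply: cvgM; [exact: cvg_cst|exact: gl].
have h5 : {ae mu M, forall U n, setT U ->
    (`|(weight k (@absdet R M U) * g_ n (ln (absdet U)))%:E| <= (weight k (@absdet R M U))%:E)%E}.
  apply: aeW => U n _; rewrite lee_fin normrM ger0_norm ?weight_ge0//.
  by rewrite ler_piMr ?weight_ge0.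
have [_ _ Cv] := dominated_convergence measurableT h1 h2 h3 (@integrable_weight R k mu hmu M) h5.
apply: fine_cvg; rewrite fineK; first exact: Cv.
exact: integrable_fin_num.
Unshelve. all: by end_near. Qed.

Lemma wint_cst M (l : R) : wint M (fun=> l) = l * wint M (fun=> 1).
Proof.
rewrite /wint -RintegralZl//; last by apply: (@integrable_wint R k mu hmu M (fun=> 1) 1) => // x; rewrite normr1.
by apply: eq_Rintegral => U _; ring.
Qed.

Lemma wmean_cvg M (g_ : nat -> R -> R) (l : R) : (forall n, measurable_fun setT (g_ n)) ->
  (forall n x, `|g_ n x| <= 1) -> (forall x, g_ n x @[n --> \oo] --> l) ->
  wmean M (g_ n) @[n --> \oo] --> l.
Proof.
move=> mg g1 gl; have := wint_cvg mg g1 gl (M := M); rewrite wint_cst => h.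
rewrite -[X in _ --> X](mulfK (lt0r_neq0 (wint1_gt0 M))).
by apply: cvgM => //; exact: cvg_cst.
Qed.

Lemma ln_nat_cvg : @ln R n%:R @[n --> \oo] --> +oo.
Proof.
apply/cvgryPge => a; near=> n.
have h : expR a <= n%:R by near: n; exact: nbhs_infty_ger.
by rewrite -ler_expR lnK ?posrE// (lt_le_trans (expR_gt0 a) h).
Unshelve. all: by end_near. Qed.

Lemma sqrt_ln_cvg : (Num.sqrt (@ln R n%:R / 2))^-1 @[n --> \oo] --> 0.
Proof.
apply/cvgr0Pnorm_le => e e0; near=> n.
have h : 2 * (e^-1) ^+ 2 <= @ln R n%:R.
  by near: n; move/cvgryPge : ln_nat_cvg; exact.
have e1 : e^-1 <= Num.sqrt (@ln R n%:R / 2).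
  have ei0 : 0 <= e^-1 by rewrite invr_ge0 ltW.
  by rewrite -[leLHS](ger0_norm ei0) -sqrtr_sqr ler_wsqrtr//; lra.
rewrite ger0_norm ?invr_ge0 ?sqrtr_ge0//.
rewrite -[leRHS]invrK lef_pV2 ?posrE ?invr_gt0//.
by rewrite (lt_le_trans _ e1)// invr_gt0.
Unshelve. all: by end_near. Qed.

Lemma ln_nat_gt0 : \forall n \near \oo, 0 < @ln R n%:R.
Proof.
near=> n; have : 1 <= @ln R n%:R by near: n; move/cvgryPge : ln_nat_cvg; exact.
by move=> /(lt_le_trans ltr01).
Unshelve. all: by end_near. Qed.

(** After division of numerator and denominator by [sqrt (ln n / 2)], the terms containing [M] and
    [x] vanish in the limit; the total variance [1 + dl ^+ 2] consists of the replaced increments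
    and the initial smoothing. *)
Lemma heat_profile_cvg (V dl : R) M (x : R) : heat_profile n V dl M x @[n --> \oo] --> Q (V / Num.sqrt (1 + dl ^+ 2)).
Proof.
pose h n : R := (Num.sqrt (@ln R n%:R / 2))^-1.
have h0 : h n @[n --> \oo] --> 0 by exact: sqrt_ln_cvg.
pose ka := k%:R * ln M%:R - x.
have d0 : 0 < 1 + dl ^+ 2 by rewrite ltr_pwDl// sqr_ge0.
have c1 : V + ka * h n @[n --> \oo] --> V.
  rewrite -[X in _ --> X]addr0 -[X in _ --> _ + X](mulr0 ka).
  by apply: cvgD; [exact: cvg_cst|apply: cvgM; [exact: cvg_cst|exact: h0]].
have c2 : (1 + dl ^+ 2) - (ln M%:R / 2) * (h n * h n) @[n --> \oo] --> 1 + dl ^+ 2.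
  have : (1 + dl ^+ 2) - (ln M%:R / 2) * (h n * h n) @[n --> \oo] -->
      (1 + dl ^+ 2) - (ln M%:R / 2) * (0 * 0).
    apply: cvgB; first exact: cvg_cst.
    by apply: cvgM; [exact: cvg_cst|apply: cvgM; exact: h0].
  by rewrite !mulr0 subr0.
have c3 : Num.sqrt ((1 + dl ^+ 2) - (ln M%:R / 2) * (h n * h n)) @[n --> \oo] --> Num.sqrt (1 + dl ^+ 2).
  by apply: continuous_cvg => //; exact: sqrt_continuous.
have c4 : (V + ka * h n) / Num.sqrt ((1 + dl ^+ 2) - (ln M%:R / 2) * (h n * h n)) @[n --> \oo]
    --> V / Num.sqrt (1 + dl ^+ 2).
  by apply: cvgM => //; apply: cvgV => //; rewrite gt_eqF// sqrtr_gt0.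
have c5 : Q ((V + ka * h n) / Num.sqrt ((1 + dl ^+ 2) - (ln M%:R / 2) * (h n * h n))) @[n --> \oo]
    --> Q (V / Num.sqrt (1 + dl ^+ 2)).
  by apply: continuous_cvg => //; exact: continuous_gauss_tail.
apply: cvg_trans c5; apply: near_eq_cvg; near=> n.
have l0 : 0 < @ln R n%:R by near: n; exact: ln_nat_gt0.
pose S := Num.sqrt (@ln R n%:R / 2).
have S0 : 0 < S by rewrite sqrtr_gt0 divr_gt0.
have S2 : S ^+ 2 = @ln R n%:R / 2 by rewrite sqr_sqrtr// divr_ge0// ltW.
rewrite /heat_profile /heat_time -/S /h -/S; congr (Q _).
have -> : dl ^+ 2 * (ln n%:R / 2) + (ln n%:R - ln M%:R) / 2 =
    S ^+ 2 * (1 + dl ^+ 2 - ln M%:R / 2 * (S^-1 * S^-1)).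
  have -> : ln n%:R = 2 * S ^+ 2 by rewrite S2; field.
  by field; rewrite gt_eqF.
rewrite (@sqrtrM _ (S ^+ 2) _ (sqr_ge0 S)) sqrtr_sqr (ger0_norm (ltW S0)).
set y := Num.sqrt (1 + _ - _); rewrite invfM [RHS]mulrA; congr (_ / _).
by rewrite /ka; field; rewrite gt_eqF.
Unshelve. all: by end_near. Qed.

Lemma smooth_clt (V dl : R) : 0 < dl ->
  wmean N (fun x => Q ((V - (x - k%:R * ln N%:R) / Num.sqrt (2^-1 * ln N%:R)) / dl)) @[N --> \oo]
   --> Q (V / Num.sqrt (1 + dl ^+ 2)).
Proof.
move=> dl0; apply/cvgrPdist_le => e e0.
have C0 := step_const_ge0.
(* [M] is taken beyond the square of [y = 4 * step_const / e], which makes the telescoped error at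
   most [e / 2] for every larger [N]. *)
have [M [M2 HM]] : exists M, (2 <= M)%N /\ 2 * step_const R k * (Num.sqrt M%:R)^-1 <= e / 2.
  pose y := 4 * step_const R k / e.
  have y0 : 0 <= y by rewrite divr_ge0 ?mulr_ge0// ltW.
  exists (Num.truncn (y ^+ 2)).+2; split => //.
  have yM : y <= Num.sqrt (Num.truncn (y ^+ 2)).+2%:R.
    rewrite -[leLHS](ger0_norm y0) -sqrtr_sqr ler_wsqrtr//.
    by rewrite (le_trans (ltW (truncnS_gt _)))// ler_nat.
  rewrite ler_pdivrMr ?sqrtr_gt0 ?ltr0n//.
  apply: (@le_trans _ _ (e / 2 * y)); last by rewrite ler_wpM2l// divr_ge0// ltW.
  by rewrite /y le_eqVlt; apply/orP; left; apply/eqP; field; rewrite gt_eqF.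
have LM : wmean M (heat_profile n V dl M) @[n --> \oo] --> Q (V / Num.sqrt (1 + dl ^+ 2)).
  apply: wmean_cvg.
  - by move=> n; exact: measurable_gauss_arg.
  - by move=> n x; exact: gauss_arg_norm.
  - by move=> x; exact: heat_profile_cvg.
move/cvgrPdist_le : LM => /(_ (e / 2)); rewrite divr_gt0// => /(_ isT) LM.
near=> N.
have NM : (M <= N)%N by near: N; exact: nbhs_infty_ge.
have N0 : (0 < N)%N by rewrite (leq_trans _ NM)// (leq_trans _ M2).
have l0 : 0 < @ln R N%:R by near: N; exact: ln_nat_gt0.
have d1 : 1 <= dl ^+ 2 * (@ln R N%:R / 2).
  have h : 2 / dl ^+ 2 <= @ln R N%:R by near: N; move/cvgryPge : ln_nat_cvg; exact.
  have d2 : 0 < dl ^+ 2 by rewrite exprn_gt0.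
  by move: h; rewrite ler_pdivrMr// mulrC; lra.
(* At [j = N] no increment has been replaced, and the profile is the given test function. *)
have -> : (fun x => Q ((V - (x - k%:R * ln N%:R) / Num.sqrt (2^-1 * ln N%:R)) / dl)) = heat_profile N V dl N.
  apply/funext => x; rewrite /heat_profile /heat_time subrr mul0r addr0 [2^-1 * _]mulrC.
  rewrite (@sqrtrM _ (dl ^+ 2) _ (sqr_ge0 dl)) sqrtr_sqr ger0_norm ?(ltW dl0)//; congr (Q _).
  have S0 : 0 < Num.sqrt (@ln R N%:R / 2) by rewrite sqrtr_gt0 divr_gt0.
  by field; rewrite !gt_eqF.
have := @telescope N V dl N0 d1 M (N - M) M2; rewrite subnKC// => /(_ (leqnn _)) T.
have T2 : `|wmean N (heat_profile N V dl N) - wmean M (heat_profile N V dl M)| <= e / 2.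
  apply: le_trans T _; apply: le_trans _ HM; rewrite ler_wpM2l ?mulr_ge0//.
  by rewrite gerBl invr_ge0 sqrtr_ge0.
have T1 : `|Q (V / Num.sqrt (1 + dl ^+ 2)) - wmean M (heat_profile N V dl M)| <= e / 2 by near: N; exact: LM.
rewrite distrC in T2.
have := norm_leD T1 T2; rewrite addrA subrK => /le_trans; apply; lra.
Unshelve. all: by end_near. Qed.
End Limit.

(** * Removal of the smoothing *)

Lemma sandwich_dist (R : realType) (q q1 q2 a1 a2 t eta : R) :
  `|q - q1| <= eta -> `|q - q2| <= eta -> `|q1 - a1| <= eta -> `|q2 - a2| <= eta ->
  a1 - eta <= t -> t <= a2 + eta -> `|q - t| <= eta + eta + eta.
Proof.
rewrite !ler_norml => /andP[? ?] /andP[? ?] /andP[? ?] /andP[? ?] ? ?.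
by apply/andP; split; lra.
Qed.

Theorem theorem3 (R : realType) (k : nat) (theta V : R)
    (mu : forall N : nat, probability (MatSpace R N) R)
    (hmu : forall N : nat, is_Haar_UN (mu N)) :
  (fun N : nat => weighted_mass k theta (mu N) (@tail_event R N k theta V)
                  / weighted_mass k theta (mu N) setT)
    @ \oo --> gauss_tail V.
Proof.
pose B N : set R := [set x | V <= (x - k%:R * ln N%:R) / Num.sqrt (2^-1 * ln N%:R)].
have mB N : measurable (B N).
  pose f (x : R) := (x - k%:R * ln N%:R) / Num.sqrt (2^-1 * ln N%:R).
  have mf : measurable_fun setT f by apply: measurable_funM => //; exact: measurable_funB.
  rewrite (_ : B N = setT `&` f @^-1` `[V, +oo[%classic); first exact: mf.
  by apply/seteqP; split => x; rewrite /B /= in_itv/= andbT//; case.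
have E N : weighted_mass k theta (mu N) (@tail_event R N k theta V) / weighted_mass k theta (mu N) setT
    = wmean k mu N (\1_(B N)).
  rewrite /wmean; congr (_ / _); first exact: (weighted_massE k hmu N theta (mB N)).
  have := weighted_massE k hmu N theta measurableT.
  rewrite (_ : [set U | setT _] = setT); last by apply/seteqP; split.
  rewrite /weighted_mass => ->; congr (wint k mu N).
  by apply/funext => x; rewrite indicE in_setT.
rewrite (_ : (fun N => _) = fun N => wmean k mu N (\1_(B N))); last by apply/funext.
have mI N : measurable_fun setT (\1_(B N) : R -> R) by exact: measurable_indic.
have I1 N x : `|\1_(B N) x| <= 1 :> R by rewrite indicE; case: (_ \in _); rewrite ?normr1 ?normr0.
pose S N : R := Num.sqrt (2^-1 * ln N%:R).
pose W N (x : R) := (x - k%:R * ln N%:R) / S N.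
have mW N (v dl c : R) : measurable_fun setT (fun x => gauss_tail ((v - W N x) / dl) + c).
  apply: measurable_funD => //.
  apply: (measurableT_comp (@measurable_gauss_tail R)); apply: measurable_funM => //.
  by apply: measurable_funB => //; apply: measurable_funM => //; exact: measurable_funB.
have mW0 N (v dl : R) : measurable_fun setT (fun x => gauss_tail ((v - W N x) / dl)).
  apply: (measurableT_comp (@measurable_gauss_tail R)); apply: measurable_funM => //.
  by apply: measurable_funB => //; apply: measurable_funM => //; exact: measurable_funB.
have bQ (z : R) : `|gauss_tail z| <= 1 by rewrite ger0_norm ?gauss_tail_ge0// gauss_tail_le1.
have bW (z c : R) : `|gauss_tail z + c| <= 1 + `|c| by apply: norm_leD.
apply/cvgrPdist_le => e e0.
pose eta := e / 3.
have eta0 : 0 < eta by rewrite divr_gt0.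
(* Beyond distance [r] from its centre the tail is within [eta] of 0 or 1. As [r] depends on [eta]
   alone, the shifts [r * dl] vanish with [dl]. *)
have [r [r0 rle rge]] := gauss_tail_limits eta0.
have cdl (q : R) : (fun dl : R => gauss_tail ((V + q * dl) / Num.sqrt (1 + dl ^+ 2))) dl @[dl --> 0^'+]
    --> gauss_tail V.
  have c : {for 0, continuous (fun dl : R => gauss_tail ((V + q * dl) / Num.sqrt (1 + dl ^+ 2)))}.
    apply: continuous_comp; last exact: continuous_gauss_tail.
    apply: cvgM.
      apply: cvgD; first exact: cvg_cst.
      by apply: cvgM; [exact: cvg_cst|exact: cvg_id].
    apply: cvgV; first by rewrite expr0n addr0 sqrtr1 oner_eq0.
    apply: continuous_comp; last exact: sqrt_continuous.
    by apply: cvgD; [exact: cvg_cst|exact: sqr_continuous].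
  move: c; rewrite /prop_for /continuous_at mulr0 addr0 expr0n addr0 sqrtr1 divr1 => c.
  exact: cvg_at_right_filter.
have /cvgrPdist_le/(_ _ eta0) n1 := cdl r.
have /cvgrPdist_le/(_ _ eta0) n2 := cdl (- r).
near (0 : R)^'+ => dl.
have dl0 : 0 < dl by near: dl; exact: nbhs_right_gt.
have h1 : `|gauss_tail V - gauss_tail ((V + r * dl) / Num.sqrt (1 + dl ^+ 2))| <= eta.
  by near: dl; exact: n1.
have h2 : `|gauss_tail V - gauss_tail ((V + - r * dl) / Num.sqrt (1 + dl ^+ 2))| <= eta.
  by near: dl; exact: n2.
have lim (q : R) : \forall N \near \oo, `|gauss_tail ((V + q * dl) / Num.sqrt (1 + dl ^+ 2)) -
    wmean k mu N (fun x => gauss_tail ((V + q * dl - W N x) / dl))| <= eta.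
  by have /cvgrPdist_le/(_ _ eta0) := @smooth_clt R k mu hmu (V + q * dl) dl dl0.
apply: filterS (filterI (lim r) (lim (- r))) => N [k1 k2].
(* Where [W N x >= V], the shifted argument is at most [- r], so the smooth function is at least
   [1 - eta]; elsewhere the indicator is 0. The lower bound uses the opposite shift. *)
have up : wmean k mu N (\1_(B N)) <= wmean k mu N (fun x => gauss_tail ((V + - r * dl - W N x) / dl)) + eta.
  rewrite -(@wmeanDc R k mu hmu N _ 1)//.
  apply: (@le_wmean R k mu hmu N _ _ 1 (1 + `|eta|)) => // x.
  rewrite indicE; case: (boolP (x \in B N)) => [|_]; last by rewrite addr_ge0 ?gauss_tail_ge0// ltW.
  rewrite inE /B /= -/(S N) -/(W N x) => VW.
  rewrite -lerBlDr; apply: le_trans rge _; apply: le_gauss_tail.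
  by rewrite ler_pdivrMr// lerBlDr addrC lerD2l.
have lo : wmean k mu N (fun x => gauss_tail ((V + r * dl - W N x) / dl)) - eta <= wmean k mu N (\1_(B N)).
  rewrite -(@wmeanDc R k mu hmu N _ 1)//.
  apply: (@le_wmean R k mu hmu N _ _ (1 + `|- eta|) 1) => // x.
  rewrite indicE; case: (boolP (x \in B N)) => [_|].
    by rewrite lerBlDr (le_trans (gauss_tail_le1 _))// lerDl ltW.
  rewrite notin_setE /B /= -/(S N) -/(W N x) => /negP; rewrite -ltNge => VW.
  rewrite lerBlDr add0r; apply: le_trans _ rle; apply: le_gauss_tail.
  by rewrite ler_pdivlMr// addrAC lerDr subr_ge0 ltW.
have -> : e = eta + eta + eta by rewrite /eta; field.
exact: sandwich_dist h1 h2 k1 k2 lo up.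
Unshelve. all: by end_near. Qed.
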